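(* Let $q$ be a prime power, let $\alpha$ be a composition of $n$, let $\Delta\in\mathrm{M}_n(\mathbb{F}_q)$ be a diagonal matrix of type $\alpha$, and let $\mu$ be an integer partition. The number of subspaces of $\mathbb{F}_q^n$ with $\Delta$-profile $\mu$ is equal to $$(q-1)^{\sum_{j\ge2}\mu_j}\,q^{\sum_{j\ge2}\binom{\mu_j}{2}}\,b_{\mu\alpha}(q).$$
   Context: A subspace $W\subseteq\mathbb{F}_q^n$ has $\Delta$-profile $\mu=(\mu_1,\mu_2,\ldots)$ if $\dim(W+\Delta W+\cdots+\Delta^{j-1}W)=\mu_1+\cdots+\mu_j$ for all $j\ge1$. Type: to a diagonal matrix $\Delta$ associate the set partition $\mathcal{A}^\Delta$ of $[n]$ in which $i,j$ lie in the same block iff $\Delta(i,i)=\Delta(j,j)$. The type of $\Delta$ is the composition of $n$ obtained by listing the block sizes of $\mathcal{A}^\Delta$, the blocks being ordered by increasing least element. Polynomial $b_{\mu\alpha}(q)$: put $[n]_q=1+q+\cdots+q^{n-1}$, $[n]_q!=\prod_{i=1}^n[i]_q$, ${n\brack \beta_1,\beta_2,\ldots}_q=[n]_q!/\prod_j[\beta_j]_q!$ for nonnegative $\beta_j$ summing to $n$. For a composition $\alpha=(\alpha_1,\alpha_2,\ldots)$, $\mathrm{SSTab}(\mu,\alpha)$ is the set of all fillings of the Young diagram of $\mu$ by submultisets of $\{1^{\alpha_1},2^{\alpha_2},\ldots\}$ (i.e. entry $i$ is used at most $\alpha_i$ times) with rows weakly increasing from left to right and columns strictly increasing from top to bottom.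 For $T\in\mathrm{SSTab}(\mu,\alpha)$ with entries $b_{ij}$ (row $i$, column $j$), for each cell $(i,j)$ with $i\ge2$ let $r_{ij}(T)=\#\{j':j'\ge j,\ b_{i-1,j'}<b_{ij}\}$ and $r_q(T)=\prod_{(i,j):\,i\ge2}[r_{ij}(T)]_q$ (product over cells of $\mu$). Let $\beta^i_j$ be the number of entries equal to $i$ in row $j$ of $T$, $|\beta^i|=\sum_j\beta^i_j$, and $s_q^\alpha(T)=\prod_{i\ge1}{\alpha_i\brack \alpha_i-|\beta^i|,\beta^i_1,\beta^i_2,\ldots}_q$. Then $$b_{\mu\alpha}(q)=\sum_{T\in\mathrm{SSTab}(\mu,\alpha)}r_q(T)\,s_q^\alpha(T).$$ *)

(* Defs.v *)
From HB Require Import structures.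
From mathcomp Require Import all_boot all_order all_algebra.
From mathcomp Require Import boolp.

Set Implicit Arguments.
Unset Strict Implicit.
Unset Printing Implicit Defensive.

Import GRing.Theory.
Local Open Scope ring_scope.

(* {vspace 'cV[F]_n} has no finType instance in the library; over a finite
   field one is obtained by sending a subspace to its set of vectors. *)
Section VspaceFinite.
Variables (F : finFieldType) (n : nat).

Definition vspace_set (W : {vspace 'cV[F]_n}) : {set 'cV[F]_n} :=
  [set v | v \in W].

Definition set_vspace (A : {set 'cV[F]_n}) : {vspace 'cV[F]_n} :=
  <<enum A>>%VS.

Lemma vspace_setK : cancel vspace_set set_vspace.
Proof.
move=> W; apply/eqP; rewrite eqEsubv; apply/andP; split.
  by apply/span_subvP => v; rewrite mem_enum inE.
by apply/subvP => v Wv; apply: memv_span; rewrite mem_enum inE.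
Qed.

HB.instance Definition _ : isCountable {vspace 'cV[F]_n} :=
  CanIsCountable vspace_setK.
HB.instance Definition _ : isFinite {vspace 'cV[F]_n} :=
  CanIsFinite vspace_setK.

End VspaceFinite.

Definition is_composition (n : nat) (alpha : seq nat) : bool :=
  (0%N \notin alpha) && (sumn alpha == n).

Definition is_partition (mu : seq nat) : bool :=
  (0%N \notin mu) && sorted geq mu.

(* Since mu is padded with zeros, mu_1 + ... + mu_j is sumn (take j mu). *)
Definition has_profile (F : fieldType) (n : nat) (D : 'M[F]_n) (mu : seq nat)
    (W : {vspace 'cV[F]_n}) : Prop :=
  forall j : nat, (0 < j)%N ->
    \dim (\sum_(i < j) (linfun (mulmx (D ^+ i)) @: W))%VS = sumn (take j mu).

Definition diag_partition (F : fieldType) (n : nat) (D : 'M[F]_n) :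
    {set {set 'I_n}} :=
  preim_partition (fun i => D i i) [set: 'I_n].

(* The blocks are listed through their least elements: enum 'I_n is
   increasing, and i is kept when it is the least element of its block. *)
Definition diag_type (F : fieldType) (n : nat) (D : 'M[F]_n) : seq nat :=
  [seq #|pblock (diag_partition D) i|
     | i <- enum 'I_n & [forall k in pblock (diag_partition D) i, (i <= k)%N]].

(* q-analogues are polynomials over rat in the indeterminate q = 'X. *)
Definition qnum (n : nat) : {poly rat} := \sum_(i < n) 'X^i.

Definition qfact (n : nat) : {poly rat} := \prod_(1 <= i < n.+1) qnum i.

(* Meant for bs summing to n, where the division is exact. *)
Definition qmultinomial (n : nat) (bs : seq nat) : {poly rat} :=
  qfact n %/ \prod_(b <- bs) qfact b.

(* Cells of the Young diagram of mu.  Rows, columns and tableau entries are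
   all numbered from 0, so that the first row is row 0 and the entry k stands
   for the letter k + 1, available alpha_(k + 1) = nth 0 alpha k times. *)
Definition cell (mu : seq nat) : finType :=
  {i : 'I_(size mu) & 'I_(nth 0%N mu i)}.

Definition cell_row (mu : seq nat) (c : cell mu) : nat := tag c.
Definition cell_col (mu : seq nat) (c : cell mu) : nat := tagged c.

Definition filling (mu alpha : seq nat) : finType :=
  {ffun cell mu -> 'I_(size alpha)}.

Section Tableaux.
Variables mu alpha : seq nat.
Implicit Types (T : filling mu alpha) (c d : cell mu).

Definition bounded_content T : bool :=
  [forall k : 'I_(size alpha),
     (#|[set c | T c == k]| <= nth 0%N alpha k)%N].

Definition row_weak T : bool :=
  [forall c, forall d,
     (cell_row c == cell_row d) && (cell_col c <= cell_col d)%N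
       ==> (T c <= T d)%N].

Definition col_strict T : bool :=
  [forall c, forall d,
     (cell_col c == cell_col d) && (cell_row c < cell_row d)%N
       ==> (T c < T d)%N].

Definition SSTab : {set filling mu alpha} :=
  [set T | [&& bounded_content T, row_weak T & col_strict T]].

Definition r_stat T c : nat :=
  #|[set d | [&& (cell_row d).+1 == cell_row c, (cell_col c <= cell_col d)%N
               & (T d < T c)%N]]|.

Definition r_weight T : {poly rat} :=
  \prod_(c : cell mu | (0 < cell_row c)%N) qnum (r_stat T c).

(* beta T k j is the number of entries k in row j. *)
Definition beta T (k : 'I_(size alpha)) (j : 'I_(size mu)) : nat :=
  #|[set c | (T c == k) && (cell_row c == j)]|.

Definition s_weight T : {poly rat} :=
  \prod_(k < size alpha)
    qmultinomial (nth 0%N alpha k)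
      ((nth 0%N alpha k - \sum_(j < size mu) beta T k j)%N
         :: [seq beta T k j | j <- enum 'I_(size mu)]).

Definition b_poly : {poly rat} := \sum_(T in SSTab) r_weight T * s_weight T.

End Tableaux.

(* Main.v *)
(** Instead of subspaces W one counts matrices X with d = mu_1 rows whose row
    space is the transpose of W: each W of dimension d arises from |GL_d(q)| of
    them, and the profile of W is read off the ranks of the Krylov spaces of X.
    Let X_k be the part of X supported on the first k eigenspaces of Delta.
    The profiles of X_0, X_1, ... form a Gelfand-Tsetlin pattern, that is, a
    tableau T in SSTab(mu, alpha).  Given X_k with profile nu, write Y for the
    part of X on the next eigenspace, of dimension a and with eigenvalue c.
    As Delta - c kills Y and is injective on the earlier eigenspaces, the
    profile of X_k + Y is determined by the ranks of Y on a flag of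
    F^d whose members have dimensions d - nu_1, d - nu_2, ....
    So the number of admissible Y depends only on nu, the next profile and a; it
    is a product of counts of tuples of vectors with prescribed rank growth, and
    the product of these numbers over k is the weight of T. *)

Require Import Defs.
From mathcomp Require Import all_boot all_order all_algebra.
From mathcomp Require Import boolp.
From mathcomp Require Import zify ring.
From mathcomp Require Import mxabelem finfield.

Set Implicit Arguments.
Unset Strict Implicit.
Unset Printing Implicit Defensive.

Import Order.TTheory GRing.Theory Num.Theory.
Local Open Scope ring_scope.

(** * Counting matrices with prescribed rank growth *)

Lemma eqmx_mxrank (F : fieldType) m1 m2 n (A : 'M[F]_(m1, n)) (B : 'M[F]_(m2, n)) :
  (A :=: B)%MS -> \rank A = \rank B.
Proof. by case. Qed.

Section Counting.
Variable F : finFieldType.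
Implicit Types a B e b n : nat.

Lemma card_col_mx e1 e2 n (P : pred 'M[F]_(e1, n)) (Q : 'M[F]_(e1, n) -> pred 'M[F]_(e2, n)) :
  #|[set Z : 'M[F]_(e1 + e2, n) | P (usubmx Z) && Q (usubmx Z) (dsubmx Z)]|
  = (\sum_(Z | P Z) #|[set Z' | Q Z Z']|)%N.
Proof.
rewrite -sum1_card.
rewrite (reindex (fun p : 'M[F]_(e1, n) * 'M[F]_(e2, n) => col_mx p.1 p.2)) /=.
  rewrite (eq_bigl (fun p => P p.1 && Q p.1 p.2)); last first.
    by move=> [A B] /=; rewrite inE col_mxKu col_mxKd.
  rewrite -(pair_big_dep P Q (fun _ _ => 1%N)) /=; apply: eq_bigr => A _.
  by rewrite -sum1_card; apply: eq_bigl => B; rewrite inE.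
exists (fun Z => (usubmx Z, dsubmx Z)) => [[A B] _ | Z _] /=.
  by rewrite col_mxKu col_mxKd.
by rewrite vsubmxK.
Qed.

Lemma card_submx m n (A : 'M[F]_(m, n)) :
  #|[set v : 'rV[F]_n | (v <= A)%MS]| = (#|F| ^ \rank A)%N.
Proof. by rewrite -card_rowg; apply: eq_card => v; rewrite !inE. Qed.

(** Counts the [e]-tuples of vectors in a space of dimension [a] that raise the rank of a given
    subspace of dimension [B] by exactly [b]. The recursion splits on the first vector: [q^B]
    choices lie in the subspace, [q^a - q^B] outside. *)
Fixpoint count_ext (a B e b : nat) : nat :=
  if e isn't e'.+1 then (b == 0%N)
  else (#|F| ^ B * count_ext a B e' b
        + (if b is b'.+1 then (#|F| ^ a - #|F| ^ B) * count_ext a B.+1 e' b' else 0))%N.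

Lemma card_count_ext a B e b s l n (S : 'M[F]_(s, n)) (L : 'M[F]_(l, n)) :
  (S <= L)%MS -> \rank S = B -> \rank L = a ->
  #|[set Z : 'M[F]_(e, n) | (Z <= L)%MS && (\rank (S + Z)%MS == B + b)%N]|
  = count_ext a B e b.
Proof.
elim: e s S B b => [|e IH] s S B b SL rS rL /=.
  rewrite (eq_card (B := if b == 0%N then predT else pred0)); last first.
    move=> Z; rewrite inE [Z]flatmx0 sub0mx addsmx0 rS.
    by case: b => [|b]; rewrite ?addn0 ?eqxx //= addnS -[X in X == _]addn0 -addnS eqn_add2l.
  by case: b => [|b] /=; rewrite ?card0 // card_mx mul0n expn0.
pose P := fun z : 'rV[F]_n => (z <= L)%MS.
pose Q := fun (z : 'rV[F]_n) (Z : 'M[F]_(e, n)) => (Z <= L)%MS && (\rank ((S + z)%MS + Z)%MS == B + b)%N.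
have -> : #|[set Z : 'M[F]_(e.+1, n) | (Z <= L)%MS && (\rank (S + Z)%MS == B + b)%N]| =
   #|[set Z : 'M[F]_(1 + e, n) | P (usubmx Z) && Q (usubmx Z) (dsubmx Z)]|.
  apply: eq_card => Z; rewrite -[Z](@vsubmxK _ 1 e).
  move: (usubmx _) (dsubmx _) => u v; rewrite !inE /P /Q col_mxKu col_mxKd.
  rewrite [LHS]/= (@col_mx_sub F 1 e n u v l L) -andbA.
  congr (_ && (_ && (_ == _))); apply: eqmx_mxrank.
  by rewrite -addsmxA; apply: adds_eqmx => //; apply: eqmx_sym; apply: addsmxE.
rewrite card_col_mx (bigID (fun z => (z <= S)%MS)) /=; congr (_ + _)%N.
  rewrite (eq_bigr (fun _ => count_ext a B e b)); last first.
    move=> z /andP[_ zS]; rewrite -(IH s S B b SL rS rL); apply: eq_card => Z.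
    rewrite !inE /Q; congr (_ && (_ == _)).
    by apply: eqmx_mxrank; apply: adds_eqmx => //; apply/addsmx_idPl.
  rewrite sum_nat_const; congr (_ * _)%N.
  rewrite -rS -card_submx; apply: eq_card => z; rewrite !inE /P.
  by apply: andb_idl => zS; apply: submx_trans SL.
have cz : #|[pred z : 'rV[F]_n | (z <= L)%MS && ~~ (z <= S)%MS]| = (#|F| ^ a - #|F| ^ B)%N.
  rewrite -rL -rS -!card_submx -[in RHS](setIidPr (_ : [set v : 'rV[F]_n | (v <= S)%MS] \subset [set v | (v <= L)%MS])).
    rewrite -cardsD; apply: eq_card => z.
    by rewrite !inE andbC.
  by apply/subsetP => v; rewrite !inE => vS; apply: submx_trans SL.
have rz (z : 'rV[F]_n) : ~~ (z <= S)%MS -> \rank (S + z)%MS = B.+1.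
  move=> zS; apply/eqP; rewrite eqn_leq; apply/andP; split.
    apply: leq_trans (mxrank_adds_leqif S z) _.
    by rewrite rS -[B.+1]addn1 leq_add2l rank_leq_row.
  rewrite -rS ltnNge; apply: contra zS => h.
  apply: submx_trans (addsmxSr S z) _.
  by rewrite -(mxrank_leqif_sup (addsmxSl S z)) eqn_leq h mxrankS ?addsmxSl.
case: b @Q => [|b] Q /=.
  rewrite big1 // => z /andP[zL zS]; apply: eq_card0 => Z.
  rewrite !inE /Q addn0; apply/negP => /andP[_ /eqP h].
  by have := mxrankS (addsmxSl (S + z)%MS Z); rewrite h rz // ltnn.
rewrite -cz -sum_nat_const; apply: eq_bigr => z /andP[zL zS].
rewrite -(IH _ (S + z)%MS B.+1 b _ (rz _ zS) rL); last by rewrite addsmx_sub SL.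
by apply: eq_card => Z; rewrite !inE /Q addnS addSn.
Qed.

(** The rows are cut into consecutive blocks of sizes [ds]; each block must raise the rank reached
    so far, starting from [S], by the matching entry of [bs]. *)
Fixpoint rank_growth n m (S : 'M[F]_(m, n)) (ds bs : seq nat) : 'M[F]_(sumn ds, n) -> bool :=
  match ds, bs return 'M[F]_(sumn ds, n) -> bool with
  | d :: ds', b :: bs' => fun Z : 'M[F]_(d + sumn ds', n) =>
     (\rank (S + usubmx Z)%MS == \rank S + b)%N && rank_growth (S + usubmx Z)%MS bs' (dsubmx Z)
  | _, _ => fun _ => true
  end.

Fixpoint count_growth (a B : nat) (ds bs : seq nat) : nat :=
  match ds, bs with
  | d :: ds', b :: bs' => (count_ext a B d b * count_growth a (B + b) ds' bs')%N
  | _, _ => 1%N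
  end.

(** The number of choices for a block depends on the earlier blocks only through the rank reached,
    so the counts multiply. *)
Lemma card_rank_growth a n m l (S : 'M[F]_(m, n)) (L : 'M[F]_(l, n)) ds bs :
  (S <= L)%MS -> \rank L = a -> size ds = size bs ->
  #|[set Z : 'M[F]_(sumn ds, n) | (Z <= L)%MS && rank_growth S bs Z]|
  = count_growth a (\rank S) ds bs.
Proof.
move=> + rL; elim: ds bs m S => [|d ds IH] [|b bs] m S //= SL.
  move=> _; rewrite (eq_card (B := predT)) ?card_mx ?mul0n // => Z.
  by rewrite !inE andbT [Z]flatmx0 sub0mx.
move=> [sz].
pose P := fun z : 'M[F]_(d, n) => (z <= L)%MS && (\rank (S + z)%MS == \rank S + b)%N.
pose Q := fun (z : 'M[F]_(d, n)) (Z : 'M[F]_(sumn ds, n)) => (Z <= L)%MS && rank_growth (S + z)%MS bs Z.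
have -> : #|[set Z : 'M[F]_(d + sumn ds, n) | (Z <= L)%MS &&
     ((\rank (S + usubmx Z)%MS == \rank S + b)%N && rank_growth (S + usubmx Z)%MS bs (dsubmx Z))]| =
   #|[set Z : 'M[F]_(d + sumn ds, n) | P (usubmx Z) && Q (usubmx Z) (dsubmx Z)]|.
  apply: eq_card => Z; rewrite !inE /P /Q -[in LHS](vsubmxK Z) col_mx_sub.
  by rewrite col_mxKu col_mxKd; case: (_ <= L)%MS; case: (_ <= L)%MS; rewrite ?andbT ?andbF.
rewrite card_col_mx (eq_bigr (fun _ => count_growth a (\rank S + b) ds bs)); last first.
  move=> z /andP[zL /eqP rz]; rewrite -rz -IH ?addsmx_sub ?SL //.
rewrite sum_nat_const -(@card_count_ext a (\rank S) d b _ _ _ S L) //; congr (_ * _)%N.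
by apply: eq_card => z; rewrite !inE.
Qed.
End Counting.

(** * Flags and matrices adapted to them *)

Section Flags.
Variable F : finFieldType.

(** The row blocks of [G] are adapted to the flag [U 0 <= U 1 <= ...] above [S]: each block
    completes one member to the next. *)
Fixpoint flag (d m : nat) (S : 'M[F]_(m, d)) (U : nat -> 'M[F]_d) (ds : seq nat) :
    'M[F]_(sumn ds, d) -> Prop :=
  match ds return 'M[F]_(sumn ds, d) -> Prop with
  | e :: ds' => fun G : 'M[F]_(e + sumn ds', d) =>
      (S + usubmx G :=: U 0%N)%MS /\ flag (U 0%N) (fun i => U i.+1) (dsubmx G)
  | [::] => fun _ => True
  end.

Lemma flag_exists ds d m (S : 'M[F]_(m, d)) U :
  (0 < size ds -> (S <= U 0%N)%MS)%N ->
  (forall i, (i.+1 < size ds)%N -> (U i <= U i.+1)%MS) ->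
  (forall i, (i < size ds)%N -> \rank (U i) = (\rank S + sumn (take i.+1 ds))%N) ->
  exists G : 'M[F]_(sumn ds, d), flag S U G.
Proof.
elim: ds m S U => [|e ds IH] m S U /= SU nU rU; first by exists 0.
have [G1 G1U] : exists G1 : 'M[F]_(e, d), (S + G1 :=: U 0%N)%MS.
  (* A basis of a complement of [S] in [U 0] serves as the first block; it has exactly [e] rows. *)
  have re : \rank (U 0%N :\: S)%MS = e.
    have := mxrank_cap_compl (U 0%N) S; have := rU 0%N isT.
    rewrite take0 /= addn0 => -> /esym/eqP.
    rewrite (capmx_idPr (SU isT)) => /eqP; lia.
  rewrite -re; exists (row_base (U 0%N :\: S)%MS).
  apply: eqmx_trans (addsmx_diff_cap_eq (U 0%N) S).
  rewrite addsmxC; apply: adds_eqmx; first exact: eq_row_base.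
  by apply: eqmx_sym; apply/capmx_idPr; apply: SU.
have [||i ids|G2 G2U] := IH _ (U 0%N) (fun i => U i.+1).
- by move=> ds0; apply: nU.
- by move=> i ids; apply: nU.
- by rewrite (rU i.+1) // (rU 0%N isT) /= take0 /= addn0 addnA.
by exists (col_mx G1 G2); rewrite /= col_mxKu col_mxKd.
Qed.

Lemma flag_eqmx ds d m (S : 'M[F]_(m, d)) U (G : 'M[F]_(sumn ds, d)) :
  flag S U G -> (0 < size ds)%N -> (S + G :=: U (size ds).-1)%MS.
Proof.
elim: ds m S U G => //= e ds IH m S U G [G1 G2] _.
have E : (S + G :=: U 0%N + dsubmx G)%MS.
  apply: eqmx_trans (adds_eqmx G1 (eqmx_refl _)); rewrite -addsmxA.
  apply: adds_eqmx => //; rewrite -{1}(vsubmxK G); apply: eqmx_sym; exact: addsmxE.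
apply: eqmx_trans E _.
case: ds G IH G1 G2 => [|e' ds] G IH G1 G2.
  by rewrite [dsubmx G]flatmx0; apply: addsmx0.
exact: (IH _ _ _ _ G2).
Qed.

(** Multiplication by [Y] carries rows adapted to the flag to rows adapted to its image, so the
    ranks of [U i *m Y] become growth conditions on the blocks of [G *m Y]. *)
Lemma rank_growth_flag ds bs d n m p (S : 'M[F]_(m, d)) U (G : 'M[F]_(sumn ds, d))
    (M : 'M[F]_(p, n)) (Y : 'M[F]_(d, n)) :
  flag S U G -> (M :=: S *m Y)%MS -> size ds = size bs ->
  rank_growth M bs (G *m Y) <->
  (forall i, (i < size ds)%N -> \rank (U i *m Y) = (\rank M + sumn (take i.+1 bs))%N).
Proof.
elim: ds bs m p S U G M => [|e ds IH] [|b bs] m p S U G M //= [G1 G2] MS [sz].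
have E : (M + usubmx (G *m Y) :=: U 0%N *m Y)%MS.
  rewrite -mul_usub_mx.
  apply: eqmx_trans (eqmxMr Y G1); apply: eqmx_sym.
  apply: eqmx_trans (addsmxMr _ _ _) _.
  by apply: adds_eqmx => //; apply: eqmx_sym.
rewrite -mul_dsub_mx; split.
  move=> /andP[/eqP r0 /(IH _ _ _ _ _ _ _ G2 E sz) h] [_|i ids].
    by rewrite -(eqmx_mxrank E) r0 take0 /= addn0.
  by rewrite h // r0 addnA.
move=> h; have r0 := h 0%N isT; rewrite take0 /= addn0 in r0.
apply/andP; split; first by rewrite (eqmx_mxrank E) r0.
apply/(IH _ _ _ _ _ _ _ G2 E sz) => i ids.
by rewrite (h i.+1) // (eqmx_mxrank E) r0 /= addnA.
Qed.

(** The last member of the flag has rank [d], so the adapted matrix [G] is invertible and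
    [Y |-> G *m Y] is a bijection onto the matrices counted by [card_rank_growth]. *)
Lemma card_flag a d n l (L : 'M[F]_(l, n)) (U : nat -> 'M[F]_d) ds bs :
  \rank L = a -> size ds = size bs -> sumn ds = d -> (0 < size ds)%N ->
  (forall i, (i.+1 < size ds)%N -> (U i <= U i.+1)%MS) ->
  (forall i, (i < size ds)%N -> \rank (U i) = sumn (take i.+1 ds)) ->
  #|[set Y : 'M[F]_(d, n) | (Y <= L)%MS &&
      `[< forall i, (i < size ds)%N -> \rank (U i *m Y) = sumn (take i.+1 bs) >]]|
  = count_growth F a 0 ds bs.
Proof.
move=> rL sz sd ds0 nU rU.
have [|i ids|G GU] := @flag_exists ds d 0 0 U _ nU; first by rewrite sub0mx.
  by rewrite rU // mxrank0.
have GE : (G :=: U (size ds).-1)%MS.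
  by apply: eqmx_trans (flag_eqmx GU ds0); apply: eqmx_sym; apply: adds0mx.
have rG : \rank G = d by rewrite (eqmx_mxrank GE) rU prednK // take_size.
have fG : row_free G by rewrite /row_free rG sd.
have uG : row_full G by rewrite /row_full rG.
rewrite -{1}(@mxrank0 F 0 n) -(card_rank_growth _ rL sz) ?sub0mx //.
rewrite -(card_imset _ (row_full_inj uG (p := n))); apply: eq_card => Z.
have fl Y : rank_growth (0 : 'M_(0, n)) bs (G *m Y) <-> (forall i, (i < size ds)%N -> \rank (U i *m Y) = sumn (take i.+1 bs)).
  have := rank_growth_flag (Y := Y) (M := 0 : 'M_(0, n)) GU _ sz.
  by rewrite mxrank0; apply; rewrite mul0mx; apply: eqmx_refl.
apply/imsetP/idP => [[Y]|]; rewrite inE => /andP[YL].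
  by move=> /asboolP /fl hY ->; rewrite inE hY andbT mulmx_sub.
move=> hZ; exists (pinvmx G *m Z); last by rewrite mulmxA mulmxVp // mul1mx.
rewrite inE mulmx_sub //=; apply/asboolP/fl.
by rewrite mulmxA mulmxVp // mul1mx.
Qed.
End Flags.

(** * Krylov spaces *)

Section Krylov.
Variables (F : fieldType) (n : nat).
Implicit Types (N P Q : 'M[F]_n).

(** The row space of [X, X N, ..., X N^(j-1)] in Horner form, which suits the addition of a [Y] with
    [Y N = 0]. *)
Fixpoint krylov d N (X : 'M[F]_(d, n)) (j : nat) : 'M[F]_n :=
  if j is j'.+1 then (X + krylov N X j' *m N)%MS else 0.

Definition kdim d N (X : 'M[F]_(d, n)) j := \rank (krylov N X j).

(** Indices start at 0: [profile N X j] is the part [mu_(j+1)]. *)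
Definition profile d N (X : 'M[F]_(d, n)) j := (kdim N X j.+1 - kdim N X j)%N.

Lemma krylov_mono d N (X : 'M[F]_(d, n)) j : (krylov N X j <= krylov N X j.+1)%MS.
Proof.
elim: j => [|j IH]; first exact: sub0mx.
by rewrite /= addsmxS // submxMr.
Qed.

Lemma kdim_mono d N (X : 'M[F]_(d, n)) j : (kdim N X j <= kdim N X j.+1)%N.
Proof. exact/mxrankS/krylov_mono. Qed.

Lemma kdimS d N (X : 'M[F]_(d, n)) j : kdim N X j.+1 = (kdim N X j + profile N X j)%N.
Proof. by rewrite subnKC // kdim_mono. Qed.

Lemma kdim0 d N (X : 'M[F]_(d, n)) : kdim N X 0 = 0%N.
Proof. exact: mxrank0. Qed.

Lemma kdim_sum d N (X : 'M[F]_(d, n)) j : kdim N X j = (\sum_(i < j) profile N X i)%N.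
Proof.
elim: j => [|j IH]; first by rewrite kdim0 big_ord0.
by rewrite big_ord_recr /= -IH kdimS.
Qed.

(** The scalar term is absorbed because the Krylov spaces increase. Profiles of [D] can thus be
    computed with [D - c], which kills the eigenspace of [c]. *)
Lemma krylov_shift d N (X : 'M[F]_(d, n)) c j :
  (krylov (N - c%:M) X j :=: krylov N X j)%MS.
Proof.
elim: j => [|j IH]; first exact: eqmx_refl.
apply/eqmxP/andP; split; rewrite /= addsmx_sub addsmxSl /=.
  rewrite (eqmxMr _ IH) mulmxBr addmx_sub ?addsmxSr //.
  by rewrite eqmx_opp mul_mx_scalar scalemx_sub //; apply: (krylov_mono N X j).
rewrite -(eqmxMr _ IH) -[X in _ *m X](subrK c%:M) mulmxDr addmx_sub ?addsmxSr //.
rewrite mul_mx_scalar scalemx_sub //; apply: (krylov_mono (N - c%:M) X j).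
Qed.

Lemma profile_shift d N (X : 'M[F]_(d, n)) c j : profile (N - c%:M) X j = profile N X j.
Proof. by rewrite /profile /kdim !(eqmx_mxrank (krylov_shift _ _ _ _)). Qed.

Lemma profile0 d N j : profile N (0 : 'M[F]_(d, n)) j = 0%N.
Proof.
suff K i : krylov N (0 : 'M[F]_(d, n)) i = 0 by rewrite /profile /kdim !K mxrank0.
by elim: i => //= i ->; apply/eqP; rewrite mul0mx -submx0 addsmx_sub !sub0mx.
Qed.

(** * Adding a part killed by [N] *)

Section Step.
Variables (d : nat) (N P N' : 'M[F]_n) (X Y : 'M[F]_(d, n)).
Hypotheses (PN : P *m N = N *m P) (PP : P *m P = P) (PNN : P *m N *m N' = P).
Hypotheses (XP : X *m P = X) (YP : Y *m P = 0) (YN : Y *m N = 0).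

(** The vectors [u] of [F^d] with [u X] in [K_j N], where [K_j] is the Krylov space. They form the
    flag on which the ranks of [Y] are read. *)
Definition reach j : 'M[F]_d := kermx (X *m cokermx (krylov N X j *m N)).

Lemma sub_reach m (A : 'M[F]_(m, d)) j :
  (A <= reach j)%MS = (A *m X <= krylov N X j *m N)%MS.
Proof. by rewrite sub_kermx submxE mulmxA. Qed.

Lemma reach_mono j : (reach j <= reach j.+1)%MS.
Proof.
rewrite sub_reach; apply: submx_trans (submxMr _ (krylov_mono N X j)).
by rewrite -sub_reach.
Qed.

Lemma krylovP j : krylov N X j *m P = krylov N X j.
Proof.
suff /submxP[c ->] : (krylov N X j <= P)%MS by rewrite -mulmxA PP.
elim: j => [|j IH] /=; first exact: sub0mx.
rewrite addsmx_sub -{1}XP submxMl /=; case/submxP: IH => c ->.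
by rewrite -mulmxA PN mulmxA submxMl.
Qed.

Lemma rank_krylovN j : \rank (krylov N X j *m N) = kdim N X j.
Proof.
apply/eqP; rewrite eqn_leq mxrankM_maxl /=.
rewrite /kdim -{1}(krylovP j) -PNN !mulmxA krylovP; exact: mxrankM_maxl.
Qed.

(** The quotient of [F^d] by [reach j] is isomorphic to [(X + K_j N) / K_j N]. Its dimension is the
    profile entry, since [N] is injective on the image of [P] and so preserves the dimension of
    [K_j]. *)
Lemma rank_reach j : (\rank (reach j) + profile N X j = d)%N.
Proof.
have h1 := mxrank_mul_ker X (cokermx (krylov N X j *m N)).
have h2 := mxrank_sum_cap X (krylov N X j *m N).
have h3 := mxrank_coker (krylov N X j *m N).
have E : (kermx (cokermx (krylov N X j *m N)) :=: krylov N X j *m N)%MS.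
  apply/eqmxP/andP; split; last by rewrite sub_kermx mulmx_coker.
  by rewrite submxE mulmx_ker.
have := rank_leq_row (X *m cokermx (krylov N X j *m N)).
have := rank_krylovN j; have := kdimS N X j.
have e : kdim N X j.+1 = \rank (X + krylov N X j *m N)%MS by [].
rewrite mxrank_ker (eqmx_mxrank (cap_eqmx (eqmx_refl X) E)) -e in h1 h2 *; lia.
Qed.

Lemma krylovDN j : (krylov N (X + Y) j *m N :=: krylov N X j *m N)%MS.
Proof.
elim: j => [|j IH]; first exact: eqmx_refl.
rewrite /=; apply: eqmx_trans (addsmxMr _ _ _) _.
apply: eqmx_trans (eqmx_sym (addsmxMr _ _ _)).
rewrite mulmxDl YN addr0; apply: adds_eqmx => //; exact: eqmxMr.
Qed.

(** Rank-nullity for [P] on the Krylov space of [X + Y]: the image is the Krylov space of [X], and a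
    vector [u (X + Y) + w] with [w] in [K_j N] that [P] kills satisfies [u X = - w], so it equals
    [u Y] with [u] in [reach j]. *)
Lemma kdimD j : kdim N (X + Y) j.+1 = (kdim N X j.+1 + \rank (reach j *m Y))%N.
Proof.
rewrite /kdim -(mxrank_mul_ker _ P); congr (_ + _)%N; apply: eqmx_mxrank.
  apply: eqmx_trans (eqmxMr P (adds_eqmx (eqmx_refl _) (krylovDN j))) _.
  apply: eqmx_trans (addsmxMr _ _ _) _; rewrite mulmxDl XP YP addr0.
  by rewrite -mulmxA -PN mulmxA krylovP /=.
have E := adds_eqmx (eqmx_refl (X + Y)) (krylovDN j).
apply: eqmx_trans (cap_eqmx E (eqmx_refl _)) _; apply/eqmxP/andP; split.
  apply/rV_subP => v; rewrite sub_capmx => /andP[/sub_addsmxP[[a b] /= ->]].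
  rewrite sub_kermx => /eqP.
  have -> : (a *m (X + Y) + b *m (krylov N X j *m N)) *m P = a *m X + b *m (krylov N X j *m N).
    by rewrite mulmxDl -!mulmxA mulmxDl XP YP addr0 -PN (mulmxA _ P N) krylovP.
  move=> h; rewrite mulmxDr addrAC h add0r submxMr // sub_reach.
  move/eqP: h; rewrite addr_eq0 => /eqP ->; rewrite eqmx_opp; exact: submxMl.
rewrite sub_capmx sub_kermx -mulmxA YP mulmx0 eqxx andbT.
have -> : reach j *m Y = reach j *m (X + Y) - reach j *m X by rewrite mulmxDr addrAC subrr add0r.
rewrite addmx_sub //; first by apply: submx_trans (addsmxSl _ _); apply: submxMl.
by rewrite eqmx_opp; apply: submx_trans (addsmxSr _ _); rewrite -sub_reach.
Qed.

Lemma profile_leD j : (profile N X j <= profile N (X + Y) j)%N.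
Proof.
have := kdimS N X j; have := kdimS N (X + Y) j; have := kdimD j.
case: j => [|j]; first by rewrite !kdim0; lia.
have := kdimD j; have : (\rank (reach j *m Y) <= \rank (reach j.+1 *m Y))%N.
  by apply: mxrankS; apply: submxMr; apply: reach_mono.
lia.
Qed.

(** The kernel of [Y] on [reach j] can only grow with [j]. *)
Lemma rank_reachM_lip j : (\rank (reach j.+1 *m Y) + \rank (reach j) <= \rank (reach j *m Y) + \rank (reach j.+1))%N.
Proof.
have h1 := mxrank_mul_ker (reach j) Y; have h2 := mxrank_mul_ker (reach j.+1) Y.
have : (\rank (reach j :&: kermx Y) <= \rank (reach j.+1 :&: kermx Y))%N.
  by apply/mxrankS/capmxS => //; apply: reach_mono.
lia.
Qed.

(** By [kdimD], entry [j + 1] grows by the difference of the ranks of [reach j.+1 *m Y] and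
    [reach j *m Y], which is at most the old entry [j] minus the old entry [j + 1]. This becomes
    column strictness of the tableau. *)
Lemma profile_interlace j : (profile N (X + Y) j.+1 <= profile N X j)%N.
Proof.
have := kdimS N X j.+1; have := kdimS N (X + Y) j.+1; have := kdimD j.
have := kdimD j.+1; have := rank_reachM_lip j; have := rank_reach j; have := rank_reach j.+1.
lia.
Qed.

(** The sum telescopes to the rank of [Y] on one member of the flag. It will bound the multiplicity
    of a letter by the dimension of its eigenspace. *)
Lemma sum_profile_sub r : (\sum_(j < r) (profile N (X + Y) j - profile N X j) <= \rank Y)%N.
Proof.
have E : (kdim N (X + Y) r = kdim N X r + \sum_(j < r) (profile N (X + Y) j - profile N X j))%N.
  rewrite !kdim_sum -big_split /=; apply: eq_bigr => j _.
  by rewrite subnKC // profile_leD.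
case: r E => [|r] E; first by rewrite big_ord0.
by move: E; rewrite kdimD => /addnI <-; apply: mxrankM_maxr.
Qed.

End Step.
End Krylov.

(** * Adding one eigenspace *)

Lemma sumn_take_mkseq (f : nat -> nat) s i :
  (i <= s)%N -> sumn (take i (mkseq f s)) = (\sum_(k < i) f k)%N.
Proof.
move=> is_; rewrite /mkseq -map_take take_iota (minn_idPl is_).
by rewrite sumnE big_map -(big_mkord xpredT f) /index_iota subn0.
Qed.

Lemma sumn_mkseq (f : nat -> nat) s : sumn (mkseq f s) = (\sum_(k < s) f k)%N.
Proof. by rewrite -(sumn_take_mkseq f (leqnn s)) take_oversize ?size_mkseq. Qed.

(** Dimension steps of a flag with members of dimensions d - nu_0, d - nu_1, .... *)
Definition gaps (d : nat) (nu : nat -> nat) (k : nat) : nat :=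
  if k is k'.+1 then (nu k' - nu k)%N else (d - nu 0)%N.

(** The lists run through index [r], not [r - 1]: when [nu r = 0] the gaps sum to [d], so the flag
    ends at the whole of [F^d]. *)
Definition step_count (F : finFieldType) (a d r : nat) (nu mu : nat -> nat) : nat :=
  count_growth F a 0 (mkseq (gaps d nu) r.+1) (mkseq (fun j => mu j - nu j)%N r.+1).

(** P projects onto the earlier eigenspaces and Q onto the one of eigenvalue c;
    N' inverts N = D - c on the image of P. *)
Section Fiber.
Variables (F : finFieldType) (n d a r : nat) (D P Q N' : 'M[F]_n) (c : F).
Variables (X : 'M[F]_(d, n)) (nu mu : nat -> nat).
Let N := D - c%:M.
Hypotheses (PD : P *m D = D *m P) (PP : P *m P = P) (PNN : P *m N *m N' = P).
Hypotheses (QP : Q *m P = 0) (QQ : Q *m Q = Q) (QN : Q *m N = 0) (rQ : \rank Q = a).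
Hypotheses (XP : X *m P = X) (Xnu : forall j, profile D X j = nu j).
Hypotheses (numu : forall j, (nu j <= mu j)%N) (mu0 : forall j, (r <= j)%N -> mu j = 0%N).

(** By [kdimD] the profile of [X + Y] amounts to the ranks of [Y] on the flag [reach N X j], and
    [card_flag] counts the [Y] with given ranks. *)
Lemma card_fiber :
  #|[set Y : 'M[F]_(d, n) | (Y *m Q == Y) && `[< forall j, profile D (X + Y) j = mu j >]]|
  = step_count F a d r nu mu.
Proof.
have PN : P *m N = N *m P.
  by rewrite mulmxBr mulmxBl PD mul_mx_scalar mul_scalar_mx.
have NX j : profile N X j = nu j by rewrite profile_shift.
have nu0 j : (r <= j)%N -> nu j = 0%N by move=> /mu0 h; have := numu j; lia.
have rr j : (\rank (reach N X j) + nu j = d)%N.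
  by rewrite -(NX j) (rank_reach PN PP PNN XP).
have sg j : (\sum_(k < j.+1) gaps d nu k)%N = \rank (reach N X j).
  elim: j => [|j IH]; first by rewrite big_ord1 /=; have := rr 0%N; lia.
  rewrite big_ord_recr /= IH.
  by have := mxrankS (reach_mono N X j); have := rr j; have := rr j.+1; lia.
have full j : (r <= j)%N -> row_full (reach N X j).
  by move=> /nu0 h; rewrite /row_full; have := rr j; rewrite h addn0 => ->.
rewrite /step_count -(@card_flag F a d n n Q (reach N X)) ?size_mkseq //; last 3 first.
- by rewrite sumn_mkseq sg; have := rr r; rewrite nu0 // addn0.
- by move=> i _; apply: reach_mono.
- by move=> i ir; rewrite sumn_take_mkseq // sg.
apply: eq_card => Y; rewrite !inE.
have -> : (Y *m Q == Y) = (Y <= Q)%MS.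
  apply/eqP/idP => [<-|/submxP[A ->]]; first exact: submxMl.
  by rewrite -mulmxA QQ.
have [/submxP[A YA]|//] := boolP (Y <= Q)%MS; rewrite andTb.
have YP : Y *m P = 0 by rewrite YA -mulmxA QP mulmx0.
have YN : Y *m N = 0 by rewrite YA -mulmxA QN mulmx0.
have kD j := kdimD PN PP XP YP YN j.
have nuE j : kdim N X j = (\sum_(i < j) nu i)%N.
  by rewrite kdim_sum; apply: eq_bigr => i _.
have split_sum j : (\sum_(i < j) mu i = \sum_(i < j) nu i + \sum_(i < j) (mu i - nu i))%N.
  by rewrite -big_split /=; apply: eq_bigr => i _; rewrite subnKC.
apply/asboolP/asboolP => h.
  move=> i ir; rewrite sumn_take_mkseq //; have := kD i.
  rewrite nuE kdim_sum (eq_bigr (fun i => mu (i : 'I__))); last first.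
    by move=> k _; rewrite profile_shift h.
  by rewrite split_sum => /addnI <-.
(* Past index [r] the flag is constant and [mu] vanishes, so the ranks up to [r] fix the whole
   profile. *)
have ext0 s : (\sum_(k < (r + s).+1) (mu k - nu k) = \sum_(k < r.+1) (mu k - nu k))%N.
  elim: s => [|s IH]; first by rewrite addn0.
  by rewrite addnS big_ord_recr /= IH mu0 ?sub0n ?addn0 //; lia.
have hall j : \rank (reach N X j *m Y) = (\sum_(k < j.+1) (mu k - nu k))%N.
  have [jr|rj] := leqP j r; first by rewrite h ?sumn_take_mkseq.
  have -> : \rank (reach N X j *m Y) = \rank (reach N X r *m Y).
    by rewrite !(eqmx_mxrank (eqmxMfull _ (full _ _))) // ltnW.
  by rewrite h // sumn_take_mkseq // -(subnKC (ltnW rj)) ext0.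
have km j : kdim N (X + Y) j = (\sum_(i < j) mu i)%N.
  case: j => [|j]; first by rewrite kdim0 big_ord0.
  by rewrite kD nuE hall split_sum.
by move=> j; rewrite -(profile_shift D _ c) /profile !km big_ord_recr /= addKn.
Qed.
End Fiber.

(** * Chains of nested projections *)

Section Chain.
Variables (F : finFieldType) (n d r m : nat) (D : 'M[F]_n).
Variables (P N' : nat -> 'M[F]_n) (lam : nat -> F) (a : nat -> nat) (G : nat -> nat -> nat).
Hypotheses (P0 : P 0%N = 0) (PP : forall i k, (i <= k)%N -> P i *m P k = P i /\ P k *m P i = P i).
Hypothesis PD : forall k, P k *m D = D *m P k.
Hypothesis QN : forall k, (k < m)%N -> (P k.+1 - P k) *m (D - (lam k)%:M) = 0.
Hypothesis PNN : forall k, (k < m)%N -> P k *m (D - (lam k)%:M) *m N' k = P k.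
Hypothesis rQ : forall k, (k < m)%N -> \rank (P k.+1 - P k) = a k.

(** Induction on [k], grouping the matrices by their product with [P k]. The fiber over [X] consists
    of the [X + Y] with [Y] in the next eigenspace, and [card_fiber] shows that its size is the same
    for all [X]. *)
Lemma card_chain k : (k <= m)%N ->
  (forall j, G 0%N j = 0%N) -> (forall k j, (k < m)%N -> (G k j <= G k.+1 j)%N) ->
  (forall k j, (k <= m)%N -> (r <= j)%N -> G k j = 0%N) ->
  #|[set X : 'M[F]_(d, n) | (X *m P k == X) &&
      `[< forall i j, (i <= k)%N -> profile D (X *m P i) j = G i j >]]|
  = (\prod_(i < k) step_count F (a i) d r (G i) (G i.+1))%N.
Proof.
move=> km G0 Gm Gr; elim: k km => [_|k IH km].
  rewrite big_ord0 (eq_card (B := pred1 0)) ?card1 // => X; rewrite !inE P0 mulmx0 eq_sym.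
  case: eqP => //= ->; apply/asboolP => i j; rewrite leqn0 => /eqP ->.
  by rewrite mul0mx profile0 G0.
rewrite big_ord_recr /= -IH ?(ltnW km) //.
rewrite -[LHS]sum1_card (partition_big (fun X : 'M[F]_(d, n) => X *m P k)
  (fun X => X \in [set X : 'M[F]_(d, n) | (X *m P k == X) &&
      `[< forall i j, (i <= k)%N -> profile D (X *m P i) j = G i j >]])) /=; last first.
  move=> X; rewrite !inE => /andP[XP /asboolP h].
  rewrite -mulmxA (PP (leqnn k)).1 eqxx; apply/asboolP => i j ik.
  by rewrite -mulmxA (PP ik).2 h // ltnW.
rewrite -sum_nat_const; apply: eq_bigr => X; rewrite inE => /andP[/eqP XP /asboolP hX].
have [/[swap] _ PPk] := PP (leqnn k); have [P1 P2] := PP (leqnSn k).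
have [P3 _] := PP (leqnn k.+1).
rewrite -(@card_fiber F n d (a k) r D (P k) (P k.+1 - P k) (N' k) (lam k) X) //.
- rewrite sum1_card -[RHS](card_imset _ (addrI X)); apply: eq_card => Z.
  apply/andP/imsetP => [[]|[Y]].
    rewrite inE => /andP[/eqP ZP /asboolP hZ] /eqP ZX.
    exists (Z - X); last by rewrite addrC subrK.
    rewrite inE; apply/andP; split.
      have XP1 : X *m P k.+1 = X by rewrite -XP -mulmxA P1.
      by rewrite mulmxBr !mulmxBl ZP ZX XP XP1 subrr subr0.
    by apply/asboolP => j; rewrite addrC subrK -hZ // ZP.
  rewrite inE => /andP[/eqP YQ /asboolP hY] ->.
  have YP : Y *m P k = 0 by rewrite -YQ -mulmxA mulmxBl P2 PPk subrr mulmx0.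
  have YP1 : Y *m P k.+1 = Y by rewrite -YQ -mulmxA mulmxBl P3 P1.
  have XP1 : X *m P k.+1 = X by rewrite -XP -mulmxA P1.
  have E1 : (X + Y) *m P k = X by rewrite mulmxDl XP YP addr0.
  have E2 : (X + Y) *m P k.+1 = X + Y by rewrite mulmxDl XP1 YP1.
  rewrite inE E1 E2 !eqxx; split=> //.
  apply/asboolP => i j; rewrite leq_eqVlt => /orP[/eqP->|ik].
    by rewrite mulmxDl XP1 YP1 hY.
  rewrite mulmxDl -[Y *m P i](_ : 0 = _) ?addr0 ?hX //.
  by rewrite -(PP (ik : (i <= k)%N)).2 mulmxA YP mul0mx.
- exact: PNN.
- by rewrite mulmxBl P2 PPk subrr.
- by rewrite mulmxBl !mulmxBr P1 P2 P3 PPk subrr subr0.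
- exact: QN.
- exact: rQ.
- by move=> j; rewrite -hX // XP.
- by move=> j; apply: Gm.
- by move=> j; apply: Gr.
Qed.
End Chain.

(** * Tableaux as Gelfand-Tsetlin patterns *)

(** Used in two directions: along a row of a tableau, where small entries form an initial segment,
    and along the letters, to find the entry of a cell. *)
Lemma threshold (p : pred nat) N : (forall i, (i.+1 < N)%N -> p i.+1 -> p i) ->
  exists2 g, (g <= N)%N & forall i, (i < N)%N -> p i = (i < g)%N.
Proof.
elim: N => [|N IH] dp; first by exists 0%N.
have [i iN|g gN gP] := IH; first by apply: dp; apply: ltnW.
case pN: (p N).
  have all k : (k <= N)%N -> p (N - k)%N.
    elim: k => [|k IHk] kN; first by rewrite subn0.
    by apply: dp; rewrite subnSK // ?ltnS ?leq_subr // IHk // ltnW.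
  by exists N.+1 => // i iN; rewrite iN -(subKn (ltnSE iN)) all // leq_subr.
exists g; first by apply: leqW.
move=> i; rewrite ltnS leq_eqVlt => /orP[/eqP->|]; last exact: gP.
by rewrite pN ltnNge gN.
Qed.

Section Cells.
Variable mu : seq nat.
Implicit Types c d : cell mu.

Lemma cell_exists j i : (i < nth 0 mu j)%N -> exists c, cell_row c = j /\ cell_col c = i.
Proof.
move=> ij; have js : (j < size mu)%N by rewrite ltnNge; apply/negP => /(nth_default 0) h; rewrite h in ij.
by exists (Tagged (fun i : 'I_(size mu) => 'I_(nth 0 mu i)) (Ordinal ij : 'I_(nth 0 mu (Ordinal js)))).
Qed.

Lemma cell_inj c d : cell_row c = cell_row d -> cell_col c = cell_col d -> c = d.
Proof.
case: c d => [i a] [j b]; rewrite /cell_row /cell_col /= => /val_inj e.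
by subst j => /val_inj ->.
Qed.

Lemma cell_col_lt c : (cell_col c < nth 0 mu (cell_row c))%N.
Proof. exact: ltn_ord. Qed.

Lemma cell_row_lt c : (cell_row c < size mu)%N.
Proof. exact: ltn_ord. Qed.

Lemma big_row (R : Type) (idx : R) (op : Monoid.com_law idx) j (p : pred nat) (f : nat -> R) :
  \big[op/idx]_(c : cell mu | (cell_row c == j) && p (cell_col c)) f (cell_col c)
  = \big[op/idx]_(i < nth 0 mu j | p i) f i.
Proof.
have [js|sj] := ltnP j (size mu); last first.
  rewrite nth_default // big_ord0 big1 // => c /andP[/eqP cj _].
  by have := cell_row_lt c; rewrite cj ltnNge sj.
pose h (i : 'I_(nth 0 mu j)) : cell mu :=
  Tagged (fun i : 'I_(size mu) => 'I_(nth 0 mu i)) (i : 'I_(nth 0 mu (Ordinal js))).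
have hi : injective h.
  by move=> x y /(congr1 (@cell_col mu)) /= ?; apply: val_inj.
rewrite (eq_bigl (mem (h @: [set i : 'I_(nth 0 mu j) | p i]))).
  rewrite big_imset; last by move=> x y _ _; apply: hi.
  by apply: eq_bigl => i; rewrite inE.
move=> c; apply/andP/imsetP => [[/eqP cj pc]|[i]]; last by rewrite inE => pi ->; split; rewrite /= ?eqxx.
have ci : (cell_col c < nth 0 mu j)%N by rewrite -cj cell_col_lt.
by exists (Ordinal ci); [rewrite inE|apply: cell_inj].
Qed.

Lemma card_row j (p : pred nat) :
  #|[set c : cell mu | (cell_row c == j) && p (cell_col c)]|
  = #|[set i : 'I_(nth 0 mu j) | p i]|.
Proof.
rewrite -!sum1_card (eq_bigl (fun c => (cell_row c == j) && p (cell_col c))); last first.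
  by move=> c; rewrite inE.
by rewrite (big_row addn j p (fun _ => 1%N)); apply: eq_bigl => i; rewrite inE.
Qed.
End Cells.

Lemma big_ord_interval (R : Type) (idx : R) (op : Monoid.com_law idx) N a b (f : nat -> R) :
  (b <= N)%N ->
  \big[op/idx]_(i < N | (a <= i < b)%N) f i = \big[op/idx]_(i < b - a) f (a + i)%N.
Proof.
move=> bN; rewrite -(big_mkord (fun i => (a <= i < b)%N) f).
rewrite (eq_bigl (fun i => ((true && (i < b)) && (a <= i))%N)); last first.
  by move=> i; rewrite /= andbC.
rewrite -big_nat_widenl // -big_nat_widen // -{1}[a]add0n big_addn big_mkord.
by apply: eq_bigr => i _; rewrite addnC.
Qed.

Lemma card_ord_interval N a b : (b <= N)%N ->
  #|[set i : 'I_N | (a <= i < b)%N]| = (b - a)%N.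
Proof.
move=> bN; rewrite -sum1_card (eq_bigl (fun i : 'I_N => (a <= i < b)%N)); last first.
  by move=> i; rewrite inE.
by rewrite (big_ord_interval addn a (fun _ => 1%N) bN) sum1_card card_ord.
Qed.

Section GT.
Variables mu alpha : seq nat.
Implicit Types (T : filling mu alpha) (c d : cell mu).

(** Row [j] of the shape formed by the entries below [k]. The shapes grow from the empty one at
    [k = 0] to [mu] at [k = size alpha]. *)
Definition GT T k j : nat := #|[set c : cell mu | (cell_row c == j) && (T c < k)%N]|.

Lemma GT0 T j : GT T 0 j = 0%N.
Proof. by apply: eq_card0 => c; rewrite !inE ltn0 andbF. Qed.

Lemma GT_mono T k j : (GT T k j <= GT T k.+1 j)%N.
Proof.
by apply: subset_leq_card; apply/subsetP => c; rewrite !inE => /andP[-> /ltnW].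
Qed.

Lemma GT_max T j : GT T (size alpha) j = nth 0 mu j.
Proof.
rewrite /GT -[RHS]card_ord -cardsT.
rewrite (eq_card (B := [set c : cell mu | (cell_row c == j) && predT (cell_col c)])).
  by rewrite (card_row mu j predT); apply: eq_card => i; rewrite !inE.
by move=> c; rewrite !inE ltn_ord.
Qed.

Lemma GT_leq T k j : (GT T k j <= nth 0 mu j)%N.
Proof.
rewrite -(GT_max T); apply: subset_leq_card; apply/subsetP => c.
by rewrite !inE ltn_ord andbT => /andP[].
Qed.

Lemma GT_of_cols T k j g : (g <= nth 0 mu j)%N ->
  (forall c, cell_row c = j -> (T c < k)%N = (cell_col c < g)%N) -> GT T k j = g.
Proof.
move=> gm h; rewrite /GT.
rewrite (eq_card (B := [set c : cell mu | (cell_row c == j) && (fun i => 0 <= i < g)%N (cell_col c)])).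
  by rewrite (card_row mu j (fun i => 0 <= i < g)%N) card_ord_interval ?subn0.
by move=> c; rewrite !inE; case: eqP => //= /h ->.
Qed.

(** In a weakly increasing row the entries below [k] form an initial segment, so its length decides
    which cells belong to it. *)
Lemma row_weakP T : row_weak T ->
  forall k c, (T c < k)%N = (cell_col c < GT T k (cell_row c))%N.
Proof.
move=> rw k c; set j := cell_row c.
pose p i := [exists d : cell mu, [&& cell_row d == j, cell_col d == i & (T d < k)%N]].
have pE d : cell_row d = j -> p (cell_col d) = (T d < k)%N.
  move=> dj; apply/existsP/idP => [[d' /and3P[/eqP d'j /eqP d'd h]]|h].
    by rewrite -(cell_inj (etrans d'j (esym dj)) d'd).
  by exists d; rewrite dj !eqxx.
have [i im|g gm gP] := @threshold p (nth 0 mu j).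
  have [d [dj di]] := cell_exists im; have [d' [dj' di']] := cell_exists (ltnW im).
  rewrite -di -di' !pE //; apply: leq_ltn_trans.
  move/forallP/(_ d')/forallP/(_ d)/implyP: rw; apply.
  by rewrite dj dj' eqxx di di' /=.
have hg d : cell_row d = j -> (T d < k)%N = (cell_col d < g)%N.
  by move=> dj; rewrite -pE // gP // -dj cell_col_lt.
by rewrite (GT_of_cols gm hg) hg.
Qed.

(** Otherwise the cell of row [j + 1] in column [GT T k j] has an entry at most [k], while the cell
    above it has an entry at least [k]. *)
Lemma GT_interlace T k j : sorted geq mu -> T \in SSTab mu alpha ->
  (GT T k.+1 j.+1 <= GT T k j)%N.
Proof.
move=> smu; rewrite inE => /and3P[_ rw cs]; rewrite leqNgt; apply/negP => h.
have h1 : (GT T k j < nth 0 mu j.+1)%N by apply: leq_trans (GT_leq T k.+1 j.+1).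
have h2 : (GT T k j < nth 0 mu j)%N.
  apply: leq_trans h1 _.
  have [js|sj] := ltnP j.+1 (size mu); last by rewrite nth_default.
  exact: (sortedP 0 smu).
have [c [cj ci]] := cell_exists h1; have [d [dj di]] := cell_exists h2.
have : (T c < k.+1)%N by rewrite (row_weakP rw) cj ci.
have : (T d < k)%N = false by rewrite (row_weakP rw) dj di ltnn.
have : (T d < T c)%N.
  move/forallP/(_ d)/forallP/(_ c)/implyP: cs; apply.
  by rewrite cj dj ci di eqxx ltnS leqnn.
lia.
Qed.

Lemma GT_inj T T' : T \in SSTab mu alpha -> T' \in SSTab mu alpha ->
  (forall k j, (k <= size alpha)%N -> GT T k j = GT T' k j) -> T = T'.
Proof.
rewrite !inE => /and3P[_ rw _] /and3P[_ rw' _] h; apply/ffunP => c; apply: val_inj => /=.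
have H k : (k <= size alpha)%N -> (T c < k)%N = (T' c < k)%N.
  by move=> km; rewrite (row_weakP rw) (row_weakP rw') h.
have := H (T c).+1 (ltn_ord _); have := H (T' c).+1 (ltn_ord _).
by rewrite !ltnSn !ltnS => h1 /esym h2; apply/eqP; rewrite eqn_leq h1 h2.
Qed.

Lemma GT_beta T (k : 'I_(size alpha)) j :
  GT T k.+1 j = (GT T k j + #|[set c | (T c == k) && (cell_row c == j)]|)%N.
Proof.
rewrite /GT -cardsUI [X in (_ = _ + X)%N](_ : _ = 0%N) ?addn0; last first.
  apply: eq_card0 => c; rewrite !inE; case: (T c =P k) => [->|]; rewrite ?ltnn ?andbF //=.
apply: eq_card => c; rewrite !inE ltnS leq_eqVlt andbC -val_eqE /=.
by case: (cell_row c == j) => //=; rewrite ?andbF ?orbF ?andbT // orbC.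
Qed.


Lemma card_entry T (k : 'I_(size alpha)) :
  #|[set c | T c == k]| = (\sum_(j < size mu) (GT T k.+1 j - GT T k j))%N.
Proof.
rewrite -sum1_card (partition_big (fun c : cell mu => tag c) predT) //=.
apply: eq_bigr => j _; rewrite GT_beta addKn -sum1_card; apply: eq_bigl => c.
by rewrite !inE.
Qed.

(** The entry of a cell is the step at which the growing shapes first contain it. Interlacing makes
    the columns strict, and the size of each step bounds the content. *)
Lemma GT_exists (G : nat -> nat -> nat) :
  (forall j, G 0%N j = 0%N) ->
  (forall k j, (k < size alpha)%N -> (G k j <= G k.+1 j)%N) ->
  (forall k j, (k < size alpha)%N -> (G k.+1 j.+1 <= G k j)%N) ->
  (forall j, G (size alpha) j = nth 0 mu j) ->
  (forall k, (k < size alpha)%N ->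
     (\sum_(j < size mu) (G k.+1 j - G k j) <= nth 0 alpha k)%N) ->
  exists2 T, T \in SSTab mu alpha &
    forall k j, (k <= size alpha)%N -> GT T k j = G k j.
Proof.
set m := size alpha => G0 Gm Gi Gmax Gb.
(* Strictness concerns any two rows of a column, so the interlacing of adjacent rows is iterated. *)
have Gi' k i j : (k < m)%N -> (i < j)%N -> (G k.+1 j <= G k i)%N.
  move=> km; elim: j => // j IH; rewrite ltnS leq_eqVlt => /orP[/eqP->|ij]; first exact: Gi.
  apply: leq_trans (IH ij); exact: leq_trans (Gi k j km) (Gm k j km).
have Gmu k j : (k <= m)%N -> (G k j <= nth 0 mu j)%N.
  move=> km; rewrite -Gmax -(subKn km); elim: (m - k)%N (leq_subr k m) => [|i IH] im.
    by rewrite subn0.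
  apply: leq_trans (IH (ltnW im)); rewrite -(subnSK im); apply: Gm.
  by rewrite ltn_subrL; lia.
have /boolp.choice[f fP] : forall c, exists t : 'I_m, forall k, (k <= m)%N ->
    (t < k)%N = (cell_col c < G k (cell_row c))%N.
  move=> c.
  (* The threshold [t] is the least index for which [G t.+1] contains the cell. *)
  have [k km|t tm tP] := @threshold (fun k => G k.+1 (cell_row c) <= cell_col c)%N m.
    by apply: leq_trans; apply: Gm.
  (* [t = m] would leave the cell outside the last shape, which is [mu]. *)
  have cm := cell_col_lt c; have lt_tm : (t < m)%N.
    rewrite ltn_neqAle tm andbT; apply/eqP => tE.
    case: (m) tE tP Gmax => [|m'] tE tP Gmax; first by rewrite -Gmax G0 in cm.
    by have := tP m' (ltnSn _); rewrite Gmax tE ltnSn leqNgt cm.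
  exists (Ordinal lt_tm) => -[|k] km /=; first by rewrite G0 !ltn0.
  by rewrite ltnNge (ltnNge (cell_col c)) -tP // ltnS; lia.
have GTf k j : (k <= m)%N -> GT [ffun c => f c] k j = G k j.
  move=> km; apply: GT_of_cols (Gmu _ _ km) _ => c cj.
  by rewrite ffunE fP // cj.
exists [ffun c => f c] => //; rewrite inE; apply/and3P; split.
- apply/forallP => k; rewrite card_entry; apply: leq_trans (Gb k _) => //.
  by rewrite leq_eqVlt; apply/orP; left; apply/eqP; apply: eq_bigr => j _; rewrite !GTf // ltnW.
- apply/forallP => c; apply/forallP => d; apply/implyP => /andP[/eqP rcd ccd].
  rewrite !ffunE leqNgt fP ?(ltnW (ltn_ord _)) // -rcd -leqNgt.
  by apply: leq_trans ccd; rewrite leqNgt -fP ?(ltnW (ltn_ord _)) // ltnn.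
- apply/forallP => c; apply/forallP => d; apply/implyP => /andP[/eqP ccd rcd].
  rewrite !ffunE fP ?(ltnW (ltn_ord _)) // ccd.
  by apply: leq_trans (Gi' _ _ _ (ltn_ord (f d)) rcd); rewrite -fP.
Qed.
End GT.

(** * q-analogues and closed forms *)


Section QNum.

Lemma qnumD a b : qnum (a + b) = qnum a + 'X^a * qnum b.
Proof.
rewrite /qnum big_split_ord /=; congr (_ + _); rewrite big_distrr /=.
by apply: eq_bigr => i _; rewrite exprD.
Qed.

Lemma qfactS n : qfact n.+1 = qfact n * qnum n.+1.
Proof. by rewrite /qfact big_nat_recr. Qed.

Lemma qfact0 : qfact 0 = 1.
Proof. by rewrite /qfact big_geq. Qed.

(** Double induction: [[a+b+2] = [a+1] + q^(a+1) [b+1]] splits the last factor of the larger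
    factorial, and each summand is divisible by an induction hypothesis. *)
Lemma qfact_dvdM a b : qfact a * qfact b %| qfact (a + b).
Proof.
elim: a b => [|a IHa] b; first by rewrite qfact0 mul1r dvdpp.
elim: b => [|b IHb]; first by rewrite qfact0 mulr1 addn0 dvdpp.
rewrite addnS (qfactS (a.+1 + b)) -[X in qnum X]addnS qnumD mulrDr dvdp_add //.
  rewrite qfactS [in X in _ %| X]addSnnS mulrAC dvdp_mul // IHa //.
rewrite (qfactS b) mulrA dvdp_mul // ?IHb //; exact: dvdp_mull.
Qed.

Lemma qfact_dvd_prod bs : \prod_(b <- bs) qfact b %| qfact (sumn bs).
Proof.
elim: bs => [|b bs IH]; first by rewrite big_nil dvd1p.
rewrite big_cons /=; apply: dvdp_trans (qfact_dvdM _ _).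
exact: dvdp_mul.
Qed.

Lemma qmultinomialK n bs : sumn bs = n ->
  qmultinomial n bs * \prod_(b <- bs) qfact b = qfact n.
Proof. by move=> <-; rewrite /qmultinomial divpK // qfact_dvd_prod. Qed.

Variable q : rat.
Hypothesis q1 : 1 < q.
Definition qn n := (qnum n).[q].
Definition qf n := (qfact n).[q].
(** The q-falling factorial [[e][e-1]...[e-b+1]]; it vanishes for [b > e], since the factor [[0] =
    0] then occurs. *)
Definition qfall e b := \prod_(i < b) qn (e - i).

Lemma qn0 : qn 0 = 0.
Proof. by rewrite /qn /qnum big_ord0 horner0. Qed.

Lemma qnD a b : qn (a + b) = qn a + q ^+ a * qn b.
Proof. by rewrite /qn qnumD hornerD hornerM hornerXn. Qed.

Lemma qn1 : qn 1 = 1.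
Proof. by rewrite /qn /qnum big_ord1 expr0 hornerC. Qed.

Lemma qn_sub1 n : (q - 1) * qn n = q ^+ n - 1.
Proof.
elim: n => [|n IH]; first by rewrite qn0 mulr0 expr0 subrr.
by rewrite -addn1 qnD qn1 mulrDr IH exprD; ring.
Qed.

Lemma qfS n : qf n.+1 = qf n * qn n.+1.
Proof. by rewrite /qf qfactS hornerM. Qed.

Lemma qf0 : qf 0 = 1.
Proof. by rewrite /qf qfact0 hornerC. Qed.

Lemma qn_gt0 n : 0 < qn n.+1.
Proof.
have q0 : 0 < q by apply: lt_trans q1.
elim: n => [|n IH]; first by rewrite qn1.
by rewrite -addn1 qnD qn1 mulr1 addr_gt0 // exprn_gt0.
Qed.

Lemma qf_neq0 n : qf n != 0.
Proof.
elim: n => [|n IH]; first by rewrite qf0 oner_neq0.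
by rewrite qfS mulf_neq0 // gt_eqF // qn_gt0.
Qed.

Lemma qfallSl e b : qfall e.+1 b.+1 = qn e.+1 * qfall e b.
Proof. by rewrite /qfall big_ord_recl subn0. Qed.

Lemma qfallSr e b : qfall e b.+1 = qfall e b * qn (e - b).
Proof. by rewrite /qfall big_ord_recr. Qed.

Lemma qfall_small e b : (e < b)%N -> qfall e b = 0.
Proof.
move=> eb; rewrite /qfall (bigD1 (Ordinal eb)) //= subnn qn0; exact: mul0r.
Qed.

Lemma qfall0 e : qfall e 0 = 1.
Proof. exact: big_ord0. Qed.

Lemma qf_fall e b : (b <= e)%N -> qfall e b * qf (e - b) = qf e.
Proof.
elim: b => [|b IH] be; first by rewrite qfall0 mul1r subn0.
by rewrite qfallSr -mulrA [qn _ * _]mulrC -(subnSK be) -qfS (subnSK be) IH // ltnW.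
Qed.

(** Each factor is [q^a - q^i = q^i (q - 1) [a - i]]. The product on the left counts the independent
    [b]-tuples in dimension [a]. *)
Lemma prod_sub_expr a b : (b <= a)%N ->
  (\prod_(i < b) (q ^+ a - q ^+ i)) * qf (a - b) = (q - 1) ^+ b * q ^+ 'C(b, 2) * qf a.
Proof.
elim: b => [|b IH] ba; first by rewrite big_ord0 subn0 !mul1r.
have e : q ^+ a - q ^+ b = q ^+ b * ((q - 1) * qn (a - b)).
  by rewrite qn_sub1 mulrBr -exprD subnKC ?mulr1 // ltnW.
have h : qf (a - b) = qf (a - b.+1) * qn (a - b) by rewrite -(subnSK ba) qfS.
have {IH} := IH (ltnW ba); rewrite h big_ord_recr /= e binS bin1 exprD exprS => IH.
transitivity (q ^+ b * (q - 1) * ((\prod_(i < b) (q ^+ a - q ^+ i)) * (qf (a - b.+1) * qn (a - b)))).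
  by ring.
by rewrite IH; ring.
Qed.
End QNum.

(** * Closed forms of the counts *)

Section Ext.
Variable F : finFieldType.
Let q : rat := #|F|%:R.

Lemma card_gt1 : 1 < q.
Proof. by rewrite /q ltr1n card_finNzRing_gt1. Qed.

(** After division by [[b]!] this is [q^(B(e-b))] times a q-binomial coefficient times the product.
    The bound on [B + b] makes the truncated difference in [count_ext] a true one. *)
Lemma count_ext_closed a B e b : (B + b <= a)%N ->
  (count_ext F a B e b)%:R * qf q b
  = q ^+ (B * (e - b)) * qfall q e b * \prod_(i < b) (q ^+ a - q ^+ (B + i)).
Proof.
elim: e B b => [|e IH] B b Ba.
  rewrite /= sub0n muln0 expr0 mul1r; case: b Ba => [|b] Ba /=.
    by rewrite qf0 qfall0 big_ord0.
  by rewrite qfall_small // !mul0r.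
case: b Ba => [|b] Ba.
  have := IH B 0%N Ba; rewrite /= addn0 qf0 !qfall0 !big_ord0 !mulr1 natrM natrX => ->.
  by rewrite !subn0 mulnS exprD.
rewrite [count_ext _ _ _ _ _]/= natrD !natrM natrB ?leq_pexp2l ?natrX; first last.
- by rewrite (leq_trans _ Ba) // leq_addr.
- by apply: ltnW; apply: card_finNzRing_gt1.
- by [].
rewrite -[#|F|%:R]/q.
rewrite mulrDl -!mulrA (IH B b.+1 Ba) (qfS q b) [_%:R * (_ * _)]mulrA IH; last by rewrite addSnnS.
rewrite -/q qfallSl qfallSr big_ord_recl addn0 subSS /=.
have -> : \prod_(i < b) (q ^+ a - q ^+ (B + bump 0 i)) = \prod_(i < b) (q ^+ a - q ^+ (B.+1 + i)).
  by apply: eq_bigr => i _; rewrite /bump /= add1n addSnnS.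
set p := \prod_(i < b) _.
have [be|eb] := leqP b e; last by rewrite (qfall_small _ eb); ring.
(* The q-Pascal splitting; its two terms match the two cases for the first vector. *)
have -> : qn q e.+1 = qn q (e - b) + q ^+ (e - b) * qn q b.+1.
  by rewrite -qnD addnS subnK.
have -> : q ^+ (B.+1 * (e - b)) = q ^+ (B * (e - b)) * q ^+ (e - b) by rewrite mulSn addnC exprD.
(* At [e = b] the exponent [e - b.+1] is truncated, but there the factor [[e - b]] is zero. *)
have key : q ^+ B * (q ^+ (B * (e - b.+1)) * qn q (e - b)) = q ^+ (B * (e - b)) * qn q (e - b).
  case: (ltngtP b e) be => // [be|->] _; last by rewrite subnn qn0 !mulr0.
  by rewrite mulrA -exprD -mulnS subnSK.
transitivity (q ^+ B * (q ^+ (B * (e - b.+1)) * qn q (e - b)) * qfall q e b * ((q ^+ a - q ^+ B) * p)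
  + (q ^+ a - q ^+ B) * (q ^+ (B * (e - b)) * q ^+ (e - b) * qfall q e b * p * qn q b.+1)).
  by ring.
by rewrite key; ring.
Qed.

Lemma count_growth_mkseq a B (f g : nat -> nat) s :
  count_growth F a B (mkseq f s) (mkseq g s)
  = (\prod_(j < s) count_ext F a (B + \sum_(i < j) g i) (f j) (g j))%N.
Proof.
elim: s f g B => [|s IH] f g B; first by rewrite big_ord0.
have e (h : nat -> nat) : mkseq h s.+1 = h 0%N :: mkseq (fun i => h i.+1) s.
  by rewrite /mkseq /= (iotaDl 1 0 s) -map_comp.
rewrite !e /= IH big_ord_recl big_ord0 addn0; congr (_ * _)%N.
apply: eq_bigr => j _; congr (count_ext _ _ _ _ _).
by rewrite big_ord_recl addnA.
Qed.

Section Step.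
Variables (a d r : nat) (nu mu : nat -> nat).
Let b j := (mu j - nu j)%N.
Hypothesis numu : forall j, (nu j <= mu j)%N.
Hypothesis bd : forall j, (b j <= gaps d nu j)%N.
Hypothesis nu_dec : forall j, (nu j.+1 <= nu j)%N.
Hypothesis mu0 : forall j, (r <= j)%N -> mu j = 0%N.
Hypothesis ba : (\sum_(j < r) b j <= a)%N.

(** Comes from expanding the binomials of [mu i = b i + nu i]. The term with [nu J] makes the
    identity hold for partial sums; it disappears at [J = r], where [nu] vanishes. *)
Lemma step_exponent J : (\sum_(j < J.+1) (\sum_(i < j) b i) * (gaps d nu j - b j)
   + 'C(\sum_(i < J.+1) b i, 2) + (\sum_(i < J.+1) b i) * nu J + \sum_(i < J.+1) 'C(nu i, 2)
   = \sum_(i < J.+1) 'C(mu i, 2))%N.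
Proof.
have C2D x y : ('C(x + y, 2) = 'C(x, 2) + 'C(y, 2) + x * y)%N.
  elim: x => [|x IH]; first by rewrite bin0n add0n addn0.
  by rewrite addSn !binS !bin1 IH; nia.
have mE i : mu i = (b i + nu i)%N by rewrite /b subnK.
elim: J => [|J IH].
  rewrite !big_ord1 big_ord0 mul0n add0n /= mE C2D. lia.
rewrite !(big_ord_recr J.+1) /= -IH (mE J.+1) !C2D.
have := bd J.+1; rewrite /=.
set x := (\sum_(i < J.+1) b i)%N; have := nu_dec J.
set y := nu J; set z := nu J.+1; set t := b J.+1 => zy ty.
have -> : (y - z - t = y - (z + t))%N by lia.
have -> : y = (y - (z + t) + (z + t))%N by lia.
set w := (y - (z + t))%N; rewrite addnK; nia.
Qed.

(** The powers of [q] for [nu] and [mu] stand on opposite sides so that successive steps telescope.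
    The multinomial is the contribution of one letter to [s_weight], and the falling factorials with
    [j > 0] are its contribution to [r_weight]. *)
Lemma step_closed :
  q ^+ (\sum_(j < r) 'C(nu j, 2)) * (step_count F a d r nu mu)%:R
  = q ^+ (\sum_(j < r) 'C(mu j, 2)) * (q - 1) ^+ (\sum_(j < r) b j)
    * (qmultinomial a ((a - \sum_(j < r) b j)%N :: [seq b (val j) | j <- enum 'I_r])).[q]
    * \prod_(j < r) qfall q (gaps d nu j) (b j).
Proof.
set s := (\sum_(j < r) b j)%N.
have br : b r = 0%N by rewrite /b mu0.
have nur : nu r = 0%N by have := numu r; rewrite mu0 //; lia.
have sr : (\sum_(j < r.+1) b j = s)%N by rewrite big_ord_recr /= br addn0.
have qm := congr1 (fun p => p.[q]) (@qmultinomialK a ((a - s)%N :: [seq b (val j) | j <- enum 'I_r]) _).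
have {qm} : (qmultinomial a ((a - s)%N :: [seq b (val j) | j <- enum 'I_r])).[q]
   * (qf q (a - s) * \prod_(j < r) qf q (b j)) = qf q a.
  rewrite -[RHS]qm; last by rewrite /= sumnE big_map big_enum subnK.
  by rewrite hornerM big_cons hornerM big_map big_enum /= [X in _ = _ * (_ * X)]horner_prod.
set M := (qmultinomial _ _).[q] => qm.
(* Each block starts at the rank reached by the previous one, so the factors [q^a - q^(B + i)] of
   all blocks join into a single product over [i < s]. *)
have : (step_count F a d r nu mu)%:R * \prod_(j < r) qf q (b j)
  = q ^+ (\sum_(j < r.+1) (\sum_(i < j) b i) * (gaps d nu j - b j))
    * \prod_(j < r) qfall q (gaps d nu j) (b j) * \prod_(i < s) (q ^+ a - q ^+ i).
  rewrite /step_count count_growth_mkseq.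
  have -> : \prod_(j < r) qf q (b j) = \prod_(j < r.+1) qf q (b j).
    by rewrite big_ord_recr /= br qf0 mulr1.
  have -> : \prod_(j < r) qfall q (gaps d nu j) (b j) = \prod_(j < r.+1) qfall q (gaps d nu j) (b j).
    by rewrite big_ord_recr /= br qfall0 mulr1.
  have ba1 : (\sum_(j < r.+1) b j <= a)%N by rewrite sr.
  rewrite -sr natr_prod -big_split /=.
  elim: (r.+1) ba1 => [|J IH] Ja; first by rewrite !big_ord0 expr0 !mulr1.
  rewrite !(big_ord_recr J) /= -/(b J) in Ja *.
  rewrite IH; last by apply: leq_trans Ja; apply: leq_addr.
  rewrite add0n count_ext_closed // exprD.
  rewrite big_split_ord /=; ring.
move=> h; have q1 := card_gt1.
(* The multinomial is known only through the product [qm], so both sides are multiplied by its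
   nonzero denominator. *)
have nz : qf q (a - s) * \prod_(j < r) qf q (b j) != 0.
  by rewrite mulf_neq0 ?qf_neq0 //; apply/prodf_neq0 => j _; apply: qf_neq0.
apply: (mulIf nz).
transitivity (q ^+ (\sum_(j < r) 'C(nu j, 2)) * qf q (a - s) *
   ((step_count F a d r nu mu)%:R * \prod_(j < r) qf q (b j))); first by ring.
rewrite h.
transitivity (q ^+ (\sum_(j < r) 'C(nu j, 2)) * q ^+ (\sum_(j < r.+1) (\sum_(i < j) b i) * (gaps d nu j - b j))
  * \prod_(j < r) qfall q (gaps d nu j) (b j) * ((\prod_(i < s) (q ^+ a - q ^+ i)) * qf q (a - s))); first by ring.
rewrite prod_sub_expr // -[in LHS]qm.
have := step_exponent r; rewrite sr nur muln0 addn0 !(big_ord_recr r) /= nur mu0 // !bin0n !addn0 => <-.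
rewrite !exprD; ring.
Qed.
End Step.
End Ext.

(** * Matching the counts with the tableau weights *)

Section Weights.
Variables (F : finFieldType) (mu alpha : seq nat) (T : filling mu alpha).
Let q : rat := #|F|%:R.
Let r := size mu.
Let m := size alpha.
Let d := nth 0%N mu 0.
Let b k j := (GT T k.+1 j - GT T k j)%N.
Hypotheses (smu : sorted geq mu) (ssT : T \in SSTab mu alpha).

Let rw : row_weak T.
Proof. by move: ssT; rewrite inE => /and3P[]. Qed.

Lemma GT_out k j : (r <= j)%N -> GT T k j = 0%N.
Proof. by move=> rj; have := GT_leq T k j; rewrite nth_default //; lia. Qed.

Lemma s_weightE : (s_weight T).[q] = \prod_(k < m)
   (qmultinomial (nth 0%N alpha k) ((nth 0%N alpha k - \sum_(j < r) b k j)%N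
      :: [seq b k (val j) | j <- enum 'I_r])).[q].
Proof.
have bE (k : 'I_m) (j : 'I_r) : beta T k j = b k j by rewrite /b GT_beta addKn.
rewrite /s_weight horner_prod; apply: eq_bigr => k _.
rewrite (eq_bigr (fun j : 'I_r => b k j)) => [|j _]; last exact: bE.
by rewrite (eq_map (bE k)).
Qed.

(** By [row_weakP] the smaller entries of the row above fill an initial segment of it; those from
    column [cell_col c] on are counted. *)
Lemma r_statE c : (0 < cell_row c)%N ->
  r_stat T c = (GT T (T c) (cell_row c).-1 - cell_col c)%N.
Proof.
move=> c0; rewrite -(card_ord_interval _ (GT_leq T (T c) (cell_row c).-1)) 
  -(card_row mu _ (fun i => cell_col c <= i < GT T (T c) (cell_row c).-1)%N).
apply: eq_card => e; rewrite !inE -{1}(prednK c0) eqSS.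
case: eqP => //= ej; congr (_ && _).
by rewrite (row_weakP rw) ej.
Qed.

(** The entries [k] of row [j] start at column [GT T k j], and their statistics descend by one from
    [GT T k j.-1 - GT T k j], which is the gap [j]. *)
Lemma r_weightE : (r_weight T).[q] =
  \prod_(k < m) \prod_(j < r | (0 < j)%N) qfall q (gaps d (GT T k) j) (b k j).
Proof.
rewrite /r_weight horner_prod (partition_big T predT) //=; apply: eq_bigr => k _.
rewrite (partition_big (fun c : cell mu => tag c) (fun j : 'I_r => 0 < j)%N); last first.
  by move=> c /andP[].
apply: eq_bigr => j j0.
rewrite (eq_bigl (fun c : cell mu => (cell_row c == j) && (fun i => GT T k j <= i < GT T k.+1 j)%N (cell_col c))).
  rewrite (eq_bigr (fun c => (fun i => qn q (GT T k j.-1 - i)) (cell_col c))).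
    rewrite (big_row mu *%R j (fun i => GT T k j <= i < GT T k.+1 j)%N (fun i => qn q (GT T k j.-1 - i))).
    rewrite (@big_ord_interval _ _ *%R _ _ _ (fun i => qn q (GT T k j.-1 - i)) (GT_leq T k.+1 j)) /qfall.
    have -> : gaps d (GT T k) j = (GT T k j.-1 - GT T k j)%N by case: (nat_of_ord j) j0.
    by apply: eq_bigr => i _; rewrite subnDA.
  move=> c /andP[/eqP cj cc]; have Tc : T c = k.
    apply: val_inj => /=; apply/eqP; rewrite eqn_leq -ltnS (row_weakP rw) cj.
    have /andP[c1 ->] := cc; rewrite leqNgt (row_weakP rw) cj -leqNgt c1 //.
  by rewrite /= r_statE ?cj // Tc.
move=> c; rewrite /cell_row; case: (tag c =P j) => [cj|]; last by move=> h; rewrite andbF; apply/esym/negP => /andP[/eqP /val_inj].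
rewrite andbT cj eqxx j0 /= -val_eqE /= eqn_leq -ltnS (row_weakP rw) andbC.
have e : cell_row c = j by rewrite /cell_row cj.
by rewrite e; congr (_ && _); rewrite leqNgt (row_weakP rw) e -leqNgt.
Qed.

(** The falling factorials of row 0 continue one another. At [k = m] they give [[d]!], a factor of
    the order of [GL_d(q)]. *)
Lemma first_row_prod k : (k <= m)%N ->
  (\prod_(i < k) qfall q (gaps d (GT T i) 0) (b i 0%N)) * qf q (d - GT T k 0) = qf q d.
Proof.
elim: k => [|k IH] km; first by rewrite big_ord0 GT0 subn0 mul1r.
rewrite big_ord_recr /= -[RHS](IH (ltnW km)) -mulrA; congr (_ * _).
have hm := GT_mono T k 0; have hl := GT_leq T k.+1 0.
have -> : (d - GT T k.+1 0 = (d - GT T k 0) - b k 0)%N by rewrite /b -subnDA subnKC.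
by apply: qf_fall; rewrite /b leq_sub2r.
Qed.

Lemma b_le_gaps k j : (b k j <= gaps d (GT T k) j)%N.
Proof.
rewrite /b; case: j => [|j] /=; first by apply: leq_sub2r; apply: GT_leq.
by apply: leq_sub2r; apply: GT_interlace.
Qed.

Lemma b_bounded (k : 'I_m) : (\sum_(j < r) b k j <= nth 0%N alpha k)%N.
Proof.
rewrite -card_entry; move: ssT; rewrite inE => /and3P[/forallP/(_ k) + _ _]; exact.
Qed.

Lemma GT_dec k j : (k < m)%N -> (GT T k j.+1 <= GT T k j)%N.
Proof. by move=> km; apply: leq_trans (GT_interlace k j smu ssT); apply: GT_mono. Qed.

Lemma steps_closed k : (k <= m)%N ->
  \prod_(i < k) (step_count F (nth 0%N alpha i) d r (GT T i) (GT T i.+1))%:R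
  = q ^+ (\sum_(j < r) 'C(GT T k j, 2)) * (q - 1) ^+ (\sum_(j < r) GT T k j)
    * \prod_(i < k) ((qmultinomial (nth 0%N alpha i) ((nth 0%N alpha i - \sum_(j < r) b i j)%N
      :: [seq b i (val j) | j <- enum 'I_r])).[q] *
       \prod_(j < r) qfall q (gaps d (GT T i) j) (b i j)).
Proof.
elim: k => [|k IH] km.
  rewrite !big_ord0 (eq_bigr (fun _ => 0%N)) => [|j _]; last by rewrite GT0.
  rewrite [X in _ ^+ X * _ * _]big1_eq (eq_bigr (fun _ => 0%N)) => [|j _]; last by rewrite GT0.
  by rewrite big1_eq !expr0 !mulr1.
rewrite big_ord_recr /= IH ?(ltnW km) //.
have S := @step_closed F (nth 0%N alpha k) d r (GT T k) (GT T k.+1) (GT_mono T k)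
  (b_le_gaps k) (fun j => GT_dec j km) (fun j h => GT_out k.+1 h) (b_bounded (Ordinal km)).
rewrite -/q in S.
set E := \prod_(i < k) _.
rewrite -[X in X * _]mulrA mulrAC S big_ord_recr /=.
have -> : (\sum_(j < r) GT T k.+1 j = \sum_(j < r) GT T k j + \sum_(j < r) b k j)%N.
  by rewrite -big_split /=; apply: eq_bigr => j _; rewrite /b subnKC // GT_mono.
have alg (U V M P v x : rat) : U * V * M * P * (v * x) = U * (v * V) * (x * (M * P)) by ring.
by rewrite exprD; apply: alg.
Qed.

Lemma steps_weight :
  \prod_(i < m) (step_count F (nth 0%N alpha i) d r (GT T i) (GT T i.+1))%:R
  = q ^+ (\sum_(x <- mu) 'C(x, 2)) * (q - 1) ^+ (sumn mu) * qf q d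
    * ((r_weight T).[q] * (s_weight T).[q]).
Proof.
rewrite steps_closed // big_split /= -s_weightE r_weightE.
have sE (f : nat -> nat) : (\sum_(x <- mu) f x = \sum_(j < r) f (GT T m j))%N.
  rewrite (big_nth 0%N) big_mkord; apply: eq_bigr => j _; by rewrite GT_max.
rewrite sumnE (sE (fun x => 'C(x, 2))) (sE id).
have -> : \prod_(i < m) \prod_(j < r) qfall q (gaps d (GT T i) j) (b i j)
  = qf q d * \prod_(i < m) \prod_(j < r | (0 < j)%N) qfall q (gaps d (GT T i) j) (b i j).
  (* For empty [mu] the default of [nth] gives [d = 0], and both sides are 1. *)
  case r0: r => [|r'].
    rewrite big1; last by move=> i _; rewrite big_ord0.
    rewrite big1; last by move=> i _; rewrite big_ord0.
    by rewrite /d nth_default ?qf0 ?mulr1 // -/r r0.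
  rewrite -(first_row_prod (leqnn m)) GT_max subnn qf0 mulr1 -big_split /=.
  apply: eq_bigr => i _; rewrite (bigD1 ord0) //=; congr (_ * _).
  by apply: eq_bigl => j; rewrite lt0n -val_eqE.
have alg (u v x y z : rat) : u * v * (x * (y * z)) = u * v * y * (z * x) by ring.
exact: alg.
Qed.
End Weights.

(** * Diagonal matrices and subspaces *)

Section Diagonal.
Variables (F : fieldType) (n : nat).
Implicit Types f g : 'I_n -> F.

Definition diag_of f : 'M[F]_n := diag_mx (\row_i f i).

Lemma diag_ofM f g : diag_of f *m diag_of g = diag_of (fun i => f i * g i).
Proof.
apply/matrixP => i j; rewrite mul_diag_mx !mxE.
by case: (i =P j) => [->|]; rewrite ?mulr1n ?mulr0n ?mulr0.
Qed.

Lemma diag_ofB f g : diag_of f - diag_of g = diag_of (fun i => f i - g i).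
Proof. by apply/matrixP => i j; rewrite !mxE mulrnBl. Qed.

Lemma diag_ofC c : c%:M = diag_of (fun=> c).
Proof. by apply/matrixP => i j; rewrite !mxE. Qed.

Lemma eq_diag_of f g : f =1 g -> diag_of f = diag_of g.
Proof. by move=> h; apply/matrixP => i j; rewrite !mxE h. Qed.

Lemma diag_of_eq0 f : (forall i, f i = 0) -> diag_of f = 0.
Proof. by move=> h; apply/matrixP => i j; rewrite !mxE h mul0rn. Qed.

Lemma rank_diag_of (p : pred 'I_n) : \rank (diag_of (fun i => (p i)%:R)) = #|p|.
Proof.
have rowE i : row i (diag_of (fun i => (p i)%:R)) = (p i)%:R *: delta_mx 0 i.
  by rewrite /diag_of row_diag_mx mxE.
have E : (diag_of (fun i => (p i)%:R) :=: \sum_(i | p i) <<delta_mx 0 i : 'rV[F]_n>>)%MS.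
  apply/eqmxP/andP; split.
    apply/row_subP => i; rewrite rowE; case: (boolP (p i)) => pi; last by rewrite scale0r sub0mx.
    by rewrite scale1r (sumsmx_sup i) // genmxE.
  apply/sumsmx_subP => i pi; rewrite genmxE.
  by apply: (@eq_row_sub _ _ _ _ _ i); rewrite rowE pi scale1r.
rewrite (eqmx_mxrank E) (mxdirectP (mxdirect_delta F (P := p) (f := id) _)) /=; last by [].
rewrite (eq_bigr (fun _ => 1%N)) => [|i _]; last by rewrite mxrank_gen mxrank_delta.
by rewrite sum1_card.
Qed.
End Diagonal.

(** * Eigenvalues in the order of the blocks *)

Section Blocks.
Variables (F : fieldType) (n : nat) (D : 'M[F]_n).
Let part := diag_partition D.
Let least i := [forall k in pblock part i, (i <= k)%N].
(** The distinct eigenvalues, listed through the same least elements as [diag_type], so that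
    multiplicities and parts of the type correspond. *)
Definition eigenlist : seq F := [seq D i i | i <- enum 'I_n & least i].

Lemma pblockE i k : (k \in pblock part i) = (D i i == D k k).
Proof.
rewrite /part /diag_partition (@pblock_equivalence_partition _ _ [set: 'I_n]) ?inE //.
by split => // /eqP ->.
Qed.

Lemma size_eigenlist : size eigenlist = size (diag_type D).
Proof. by rewrite !size_map. Qed.

Lemma eigenlist_uniq : uniq eigenlist.
Proof.
rewrite map_inj_in_uniq => [|i j]; first exact: filter_uniq (enum_uniq _).
rewrite !mem_filter => /andP[/forallP li _] /andP[/forallP lj _] ij.
apply: val_inj; apply/eqP; rewrite eqn_leq.
have /implyP -> := li j; rewrite ?pblockE ?ij //=.
by have /implyP -> := lj i; rewrite ?pblockE ?ij.
Qed.

Lemma mem_eigenlist i : D i i \in eigenlist.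
Proof.
case: (@arg_minnP _ i (fun k => D i i == D k k) val (eqxx _)) => j /eqP ij jmin.
rewrite ij; apply: map_f; rewrite mem_filter mem_enum andbT.
by apply/forallP => k; apply/implyP; rewrite pblockE -ij; apply: jmin.
Qed.

Lemma nth_diag_type k : (k < size (diag_type D))%N ->
  nth 0%N (diag_type D) k = #|[pred i | index (D i i) eigenlist == k]|.
Proof.
rewrite -size_eigenlist => km; set s := [seq i <- enum 'I_n | least i].
have ks : (k < size s)%N by move: km; rewrite size_map.
have /hasP[x0 _ _] : has predT s by rewrite has_predT (leq_ltn_trans _ ks).
rewrite /diag_type (nth_map x0) //; apply: eq_card => i; rewrite pblockE inE.
have -> : D (nth x0 s k) (nth x0 s k) = nth 0 eigenlist k by rewrite /eigenlist (nth_map x0).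
apply/eqP/eqP => [<-|<-]; first by rewrite index_uniq // eigenlist_uniq.
by rewrite nth_index // mem_eigenlist.
Qed.
End Blocks.

(** * Subspaces of column vectors as row spaces *)

Section Representation.
Variables (F : finFieldType) (n : nat).
Implicit Types (W : {vspace 'cV[F]_n}).

Definition represents m W (A : 'M[F]_(m, n)) := forall v : 'cV[F]_n, (v \in W) = (v^T <= A)%MS.

(** Transposition is a bijection between the two spaces, and over a finite field the number of
    vectors determines the dimension. *)
Lemma rep_dim m W (A : 'M[F]_(m, n)) : represents W A -> \dim W = \rank A.
Proof.
move=> WA; apply/eqP; rewrite -(eqn_exp2l _ _ (card_finNzRing_gt1 F)).
apply/eqP; rewrite -[RHS]card_submx -[LHS]card_vspace.
rewrite -(card_imset _ (@trmx_inj F n 1)); apply: eq_card => u; rewrite !inE.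
apply/imsetP/idP => [[v + ->]|uA]; first by rewrite WA.
by exists u^T; rewrite ?trmxK // WA trmxK.
Qed.

Lemma rep_image m W (A : 'M[F]_(m, n)) (M : 'M[F]_n) :
  represents W A -> represents (linfun (mulmx M) @: W)%VS (A *m M^T).
Proof.
move=> WA v; apply/memv_imgP/submxP => [[w + ->]|[c vc]].
  by rewrite WA lfunE /= trmx_mul => /submxP[c ->]; exists c; rewrite mulmxA.
exists (c *m A)^T; first by rewrite WA trmxK submxMl.
by rewrite lfunE /= -[v]trmxK vc mulmxA trmx_mul trmxK.
Qed.

Lemma rep_add m1 m2 W1 W2 (A1 : 'M[F]_(m1, n)) (A2 : 'M[F]_(m2, n)) :
  represents W1 A1 -> represents W2 A2 -> represents (W1 + W2)%VS (A1 + A2)%MS.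
Proof.
move=> h1 h2 v; apply/memv_addP/sub_addsmxP => [[v1 + [v2 + ->]]|[[c1 c2] /= vc]].
  rewrite h1 h2 => /submxP[c1 e1] /submxP[c2 e2]; exists (c1, c2).
  by rewrite linearD /= e1 e2.
exists (c1 *m A1)^T; first by rewrite h1 trmxK submxMl.
exists (c2 *m A2)^T; first by rewrite h2 trmxK submxMl.
by rewrite -[v]trmxK vc linearD.
Qed.

Definition colsp m (X : 'M[F]_(m, n)) : {vspace 'cV[F]_n} := limg (linfun (mulmx X^T : 'cV[F]_m -> 'cV[F]_n)).

Lemma rep_colsp m (X : 'M[F]_(m, n)) : represents (colsp X) X.
Proof.
move=> v; apply/memv_imgP/submxP => [[c _ ->]|[c vc]].
  by exists c^T; rewrite lfunE /= trmx_mul trmxK.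
by exists c^T; rewrite ?memvf // lfunE /= -[v]trmxK vc trmx_mul.
Qed.

Lemma rep_exists W : exists A : 'M[F]_(\dim W, n), represents W A.
Proof.
pose A := \matrix_(i < \dim W) ((vbasis W)`_i)^T.
exists A => v; apply/idP/submxP => [vW|[c vc]].
  exists (\row_i coord (vbasis W) i v); rewrite mulmx_sum_row.
  rewrite {1}(coord_vbasis vW) linear_sum; apply: eq_bigr => i _.
  by rewrite linearZ /= rowK mxE.
rewrite -[v]trmxK vc mulmx_sum_row linear_sum; apply: rpred_sum => i _.
by rewrite linearZ /= rowK trmxK rpredZ // vbasis_mem // mem_nth // size_tuple.
Qed.

Lemma rep_inj m1 m2 W1 W2 (A1 : 'M[F]_(m1, n)) (A2 : 'M[F]_(m2, n)) :
  represents W1 A1 -> represents W2 A2 -> W1 = W2 <-> (A1 :=: A2)%MS.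
Proof.
move=> h1 h2; split => [e|e].
  apply/eqmxP/rV_eqP => u; rewrite -[u]trmxK -h1 -h2 e //.
by apply/vspaceP => v; rewrite h1 h2 e.
Qed.

(** Turns the Horner form into the sum of powers used by [has_profile]. *)
Lemma krylov_recr m (N : 'M[F]_n) (X : 'M[F]_(m, n)) j :
  (krylov N X j.+1 :=: krylov N X j + X *m N ^+ j)%MS.
Proof.
elim: j => [|j IH].
  rewrite /= mul0mx expr0 mulmx1; apply/eqmxP.
  by rewrite !addsmx_sub !sub0mx addsmxSl addsmxSr.
rewrite [krylov N X j.+2]/=.
apply: eqmx_trans (adds_eqmx (eqmx_refl _) (eqmxMr N IH)) _.
apply: eqmx_trans (adds_eqmx (eqmx_refl _) (addsmxMr _ _ _)) _.
by rewrite addsmxA -mulmxA exprSr.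
Qed.

(** The powers of [D] are symmetric, which removes the transpose of [rep_image]. *)
Lemma rep_krylov m W (X : 'M[F]_(m, n)) (D : 'M[F]_n) j :
  represents W X -> (forall i, (D ^+ i)^T = D ^+ i) ->
  represents (\sum_(i < j) (linfun (mulmx (D ^+ i)) @: W))%VS (krylov D X j).
Proof.
move=> WX DT; elim: j => [|j IH].
  by rewrite big_ord0 => v; rewrite memv0 submx0 trmx_eq0.
rewrite big_ord_recr /= => v; rewrite (krylov_recr D X j).
by apply: rep_add => //; rewrite -{2}DT; apply: rep_image.
Qed.
End Representation.

Section Subspaces.
Variables (F : finFieldType) (n : nat) (D : 'M[F]_n) (mu : seq nat).
Hypothesis DT : forall i, (D ^+ i)^T = D ^+ i.
Let d := nth 0%N mu 0.

Lemma sumn_take_nth (s : seq nat) j : sumn (take j s) = (\sum_(i < j) nth 0%N s i)%N.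
Proof.
elim: s j => [|x s IH] [|j] //=; rewrite ?big_ord0 //.
  by rewrite big1 // => i _; rewrite nth_nil.
by rewrite big_ord_recl IH.
Qed.

Lemma has_profileP m W (X : 'M[F]_(m, n)) : represents W X ->
  has_profile D mu W <-> forall j, profile D X j = nth 0%N mu j.
Proof.
move=> WX; have dE j : \dim (\sum_(i < j) (linfun (mulmx (D ^+ i)) @: W))%VS = kdim D X j.
  by apply: rep_dim; apply: rep_krylov.
split=> [h j|h j j0]; last first.
  by rewrite dE kdim_sum sumn_take_nth; apply: eq_bigr => i _.
have kE i : kdim D X i = sumn (take i mu).
  by case: i => [|i]; [rewrite kdim0 take0|rewrite -dE h].
by rewrite /profile !kE !sumn_take_nth big_ord_recr addKn.
Qed.

(** Matrices are grouped by row space. Those spanning a given [W] of dimension [d] number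
    [count_ext F d 0 d d], the order of [GL_d(q)]. *)
Lemma card_profile_bases :
  #|[set X : 'M[F]_(d, n) | `[< forall j, profile D X j = nth 0%N mu j >]]|
  = (#|[set W : {vspace 'cV[F]_n} | `[< has_profile D mu W >]]| * count_ext F d 0 d d)%N.
Proof.
rewrite -[LHS]sum1_card (partition_big (fun X : 'M[F]_(d, n) => colsp X)
  (fun W => W \in [set W : {vspace 'cV[F]_n} | `[< has_profile D mu W >]])) /=; last first.
  by move=> X; rewrite !inE => /asboolP h; apply/asboolP/(has_profileP (rep_colsp X)).
rewrite -sum_nat_const; apply: eq_bigr => W; rewrite inE => /asboolP hW.
have [A WA] := rep_exists W; have hA := (has_profileP WA).1 hW.
(* The first Krylov space is the row space of [A], so the first part of the profile is its
   dimension. *)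
have rA : \rank A = d.
  by have := hA 0%N; rewrite /profile /kdim /= mul0mx mxrank0 subn0 addsmx0.
rewrite -(@card_count_ext F d 0 d d 0 _ n 0 A) ?sub0mx ?mxrank0 // sum1_card.
apply: eq_card => X; rewrite unfold_in /= !inE adds0mx add0n.
apply/andP/andP => [[_ /eqP XW]|[XA /eqP rX]].
  have E : (X :=: A)%MS by apply/(rep_inj (rep_colsp X) WA).
  by rewrite (eqmx_mxrank E) rA eqxx E.
have XW : colsp X = W.
  apply/(rep_inj (rep_colsp X) WA)/eqmxP.
  by rewrite -(mxrank_leqif_eq XA) rX rA.
by split; [apply/asboolP/(has_profileP (rep_colsp X)); rewrite XW|apply/eqP].
Qed.
End Subspaces.

(** * Sorting matrices by tableaux *)

Section Tableaux.
Variables (F : finFieldType) (n : nat) (D : 'M[F]_n) (mu : seq nat).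
Hypotheses (Ddiag : is_diag_mx D) (smu : sorted geq mu).
Let d := nth 0%N mu 0.
Let r := size mu.
Let alpha := diag_type D.
Let m := size alpha.
Let lam := eigenlist D.
Let ix (i : 'I_n) := index (D i i) lam.
(** The projection onto the first [k] eigenspaces, in the order of [eigenlist]. *)
Let P k : 'M[F]_n := diag_of (fun i => (ix i < k)%:R).
Let c k := nth 0 lam k.
(** Inverts [D - c k] on the image of [P k], where [D i i] differs from [c k]; at [c k] itself the
    convention [0^-1 = 0] applies. *)
Let N' k : 'M[F]_n := diag_of (fun i => (D i i - c k)^-1).

Lemma diag_mx_diag_of : D = diag_of (fun i => D i i).
Proof.
have /diag_mxP[e De] := Ddiag; rewrite {1}De; congr diag_mx.
by apply/rowP => i; rewrite De !mxE eqxx mulr1n.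
Qed.

Lemma trmx_diagX i : (D ^+ i)^T = D ^+ i.
Proof.
suff [f ->] : exists f, D ^+ i = diag_of f by apply: tr_diag_mx.
elim: i => [|i [f IH]]; first by exists (fun=> 1); rewrite expr0 -diag_ofC.
by exists (fun i => D i i * f i); rewrite exprS IH {1}diag_mx_diag_of; apply: diag_ofM.
Qed.

Lemma ix_lt i : (ix i < m)%N.
Proof. by rewrite /m -size_eigenlist index_mem mem_eigenlist. Qed.

Lemma Pproj0 : P 0%N = 0.
Proof. exact: diag_of_eq0. Qed.

Lemma Pproj1 : P m = 1%:M.
Proof. by rewrite diag_ofC; apply: eq_diag_of => i; rewrite ix_lt. Qed.

Lemma Pproj_mul i k : (i <= k)%N -> P i *m P k = P i /\ P k *m P i = P i.
Proof.
move=> ik; rewrite !diag_ofM; split; apply: eq_diag_of => j;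
by case: (ltnP (ix j) i) => h; rewrite ?mul0r ?mulr0 // (leq_trans h ik) mulr1.
Qed.

Lemma Pproj_comm k : P k *m D = D *m P k.
Proof. by rewrite diag_mx_diag_of !diag_ofM; apply: eq_diag_of => i; rewrite mulrC. Qed.

Lemma Qproj k : P k.+1 - P k = diag_of (fun i => (ix i == k)%:R).
Proof.
rewrite diag_ofB; apply: eq_diag_of => i; rewrite ltnS.
by case: ltngtP => _; rewrite ?subrr ?subr0.
Qed.

Lemma Qproj_ker k : (k < m)%N -> (P k.+1 - P k) *m (D - (c k)%:M) = 0.
Proof.
move=> km; rewrite Qproj {1}diag_mx_diag_of diag_ofC diag_ofB diag_ofM.
apply: diag_of_eq0 => i; case: eqP => [<-|]; last by rewrite mul0r.
by rewrite /c nth_index ?mem_eigenlist // subrr mulr0.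
Qed.

Lemma Pproj_inv k : (k < m)%N -> P k *m (D - (c k)%:M) *m N' k = P k.
Proof.
move=> km; rewrite {1}diag_mx_diag_of diag_ofC diag_ofB !diag_ofM; apply: eq_diag_of => i.
case: ltnP => ik; last by rewrite !mul0r.
rewrite mul1r divff // subr_eq0; apply/eqP => e; move: ik.
by rewrite /ix e index_uniq ?ltnn ?eigenlist_uniq // size_eigenlist.
Qed.

Lemma Qproj_rank k : (k < m)%N -> \rank (P k.+1 - P k) = nth 0%N alpha k.
Proof. by move=> km; rewrite Qproj rank_diag_of nth_diag_type. Qed.

(** The conditions of [GT_exists] hold for the profiles of the [X *m P k]: growth and interlacing
    come from adding one eigenspace, and the bound on the content from the rank of the difference of
    successive projections. *)
Lemma chain_tableau (X : 'M[F]_(d, n)) :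
  (forall j, profile D X j = nth 0%N mu j) ->
  exists2 T, T \in SSTab mu alpha &
    forall k j, (k <= m)%N -> GT T k j = profile D (X *m P k) j.
Proof.
move=> hX.
have XP k : (X *m P k) *m P k = X *m P k by rewrite -mulmxA (Pproj_mul (leqnn k)).1.
have split_X k : X *m P k.+1 = X *m P k + X *m (P k.+1 - P k).
  by rewrite -mulmxDr addrC subrK.
have QP k : (X *m (P k.+1 - P k)) *m P k = 0.
  have [_ h] := Pproj_mul (leqnSn k); have [h' _] := Pproj_mul (leqnn k).
  by rewrite -mulmxA mulmxBl h h' subrr mulmx0.
have QN k : (k < m)%N -> (X *m (P k.+1 - P k)) *m (D - (c k)%:M) = 0.
  by move=> km; rewrite -mulmxA Qproj_ker ?mulmx0.
have PN k : P k *m (D - (c k)%:M) = (D - (c k)%:M) *m P k.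
  by rewrite mulmxBr mulmxBl Pproj_comm mul_mx_scalar mul_scalar_mx.
apply: GT_exists => [j|k j km|k j km|j|k km].
- by rewrite Pproj0 mulmx0 profile0.
- rewrite split_X -!(profile_shift D _ (c k)).
  exact: (profile_leD (PN k) (Pproj_mul (leqnn k)).1 (XP k) (QP k) (QN k km)).
- rewrite split_X -!(profile_shift D _ (c k)).
  exact: (profile_interlace (PN k) (Pproj_mul (leqnn k)).1 (Pproj_inv km) (XP k) (QP k) (QN k km)).
- by rewrite Pproj1 mulmx1.
- rewrite -(Qproj_rank km); apply: leq_trans (mxrankM_maxr X _).
  rewrite (eq_bigr (fun j : 'I__ => profile (D - (c k)%:M) (X *m P k + X *m (P k.+1 - P k)) j
     - profile (D - (c k)%:M) (X *m P k) j)%N) => [|j _]; last by rewrite !profile_shift -split_X.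
  exact: (sum_profile_sub (PN k) (Pproj_mul (leqnn k)).1 (XP k) (QP k) (QN k km)).
Qed.

Lemma card_profile_tableaux :
  #|[set X : 'M[F]_(d, n) | `[< forall j, profile D X j = nth 0%N mu j >]]|
  = (\sum_(T in SSTab mu alpha)
       \prod_(i < m) step_count F (nth 0%N alpha i) d r (GT T i) (GT T i.+1))%N.
Proof.
pose chain (T : filling mu alpha) := [set X : 'M[F]_(d, n) | (X *m P m == X) &&
  `[< forall i j, (i <= m)%N -> profile D (X *m P i) j = GT T i j >]].
rewrite (eq_bigr (fun T => #|chain T|)) => [|T ssT]; last first.
  apply: esym; apply: (card_chain d (r := r) Pproj0 Pproj_mul Pproj_comm Qproj_ker Pproj_inv Qproj_rank (leqnn m)).
  - exact: GT0.
  - by move=> k j _; apply: GT_mono.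
  - by move=> k j _; apply: GT_out.
rewrite (eq_bigr (fun T => \sum_(X in chain T) 1)%N) => [|T _]; last by rewrite sum1_card.
(* After exchanging the sums, each [X] of profile [mu] must lie in exactly one [chain T], by
   [chain_tableau] and [GT_inj], and every other [X] in none. *)
rewrite (exchange_big_dep predT) //= -sum1_card big_mkcond /=; apply: eq_bigr => X _.
rewrite sum1_card inE; case: asboolP => hX.
  have [T ssT TX] := chain_tableau hX; rewrite -(cards1 T); apply: eq_card => T'.
  rewrite in_set1 [in RHS]unfold_in /= [X \in _]inE Pproj1 mulmx1 eqxx /=.
  apply/eqP/andP => [->|[ssT' /asboolP h]].
    by split => //; apply/asboolP => i j im; rewrite TX.
  by apply: (GT_inj ssT' ssT) => k j km; rewrite TX // h.
apply: esym; apply: eq_card0 => T; rewrite unfold_in /= [X \in _]inE Pproj1 mulmx1 eqxx /=.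
apply/negbTE; apply/negP => /andP[_ /asboolP h]; apply: hX => j.
by rewrite -(GT_max T) -h // Pproj1 mulmx1.
Qed.
End Tableaux.

(** * From matrices back to subspaces *)

Theorem theorem4p22 (q : nat) (F : finFieldType) (cardF : #|F| = q)
    (n : nat) (alpha : seq nat) (alpha_comp : is_composition n alpha)
    (Delta : 'M[F]_n) (Delta_diag : is_diag_mx Delta)
    (Delta_type : diag_type Delta = alpha)
    (mu : seq nat) (mu_part : is_partition mu) :
  #|[set W : {vspace 'cV[F]_n} | `[< has_profile Delta mu W >] ]|%:R
  = (q%:R - 1) ^+ (sumn (behead mu))
    * q%:R ^+ (\sum_(m <- behead mu) 'C(m, 2))%N
    * (b_poly mu alpha).[q%:R] :> rat.
Proof.
have /andP[_ smu] := mu_part; rewrite -{}Delta_type -cardF.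
have q1 := card_gt1 F; set Q : rat := #|F|%:R in q1 *; set d := nth 0%N mu 0.
(* The order of [GL_d(q)] in q-factorial form. *)
have GL : (count_ext F d 0 d d)%:R = (Q - 1) ^+ d * Q ^+ 'C(d, 2) * qf Q d.
  apply: (mulIf (qf_neq0 q1 d)); rewrite count_ext_closed ?add0n // mul0n mul1r.
  have := qf_fall Q (leqnn d); rewrite subnn qf0 mulr1 => ->.
  have := prod_sub_expr Q (leqnn d); rewrite subnn qf0 mulr1 => <-.
  by rewrite mulrC; congr (_ * _); apply: eq_bigr => i _; rewrite add0n.
have Q0 : Q != 0 by rewrite gt_eqF // (lt_trans _ q1).
have GL0 : (count_ext F d 0 d d)%:R != 0 :> rat.
  by rewrite GL !mulf_neq0 ?expf_neq0 ?qf_neq0 // subr_eq0 gt_eqF.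
(* Multiplied by the order of [GL_d(q)], the left side counts matrices with [d] rows, which are then
   sorted by tableaux. *)
apply: (mulIf GL0); rewrite -natrM -(card_profile_bases mu (trmx_diagX Delta_diag)).
rewrite (card_profile_tableaux Delta_diag smu) natr_sum.
rewrite (eq_bigr (fun T => Q ^+ (\sum_(x <- mu) 'C(x, 2)) * (Q - 1) ^+ (sumn mu) * qf Q d
    * ((r_weight T).[Q] * (s_weight T).[Q]))) => [|T ssT]; last first.
  by rewrite natr_prod steps_weight.
rewrite -big_distrr /= /b_poly horner_sum GL.
rewrite (eq_bigr (fun T => (r_weight T * s_weight T).[Q])) => [|T _]; last by rewrite hornerM.
(* The contributions of [mu_1 = d], together with [[d]!], are exactly the order of [GL_d(q)]; what
   remains runs over [behead mu]. *)
have -> : (\sum_(x <- mu) 'C(x, 2) = 'C(d, 2) + \sum_(x <- behead mu) 'C(x, 2))%N.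
  by rewrite /d; case: (mu) => [|x s]; rewrite ?big_nil ?bin0n // big_cons.
have -> : (sumn mu = d + sumn (behead mu))%N by rewrite /d; case: (mu).
have alg (x y z w u v : rat) : u * v * (x * y) * z * w = y * v * w * (x * u * z) by ring.
by rewrite !exprD; apply: alg.
Qed.
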